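(* Let $\xi$ be a non-negative integer-valued random variable with $\mathbb{E}\xi=1$ and $0<\mathrm{Var}(\xi)<\infty$, and let $\mathcal{T}_n$ be the Galton-Watson tree with offspring distribution $\xi$ conditioned to have $n$ nodes. Assume that $\mathbb{P}(\xi=r)>0$ for some $r\ge2$. Let $\overline{H}_{n,r}$ be the height of the maximal complete $r$-ary non-fringe subtree in $\mathcal{T}_n$. Then, as $n\to\infty$, $$\frac{\overline{H}_{n,r}}{\log_r(\log n)}\to1\quad\text{in probability.}$$
   Context: A plane tree is a finite rooted, ordered, unlabeled tree. For a node $v$ of $T$, the fringe subtree $T_v$ consists of $v$ and all its descendants. A plane tree $T$ contains $T'$ as a non-fringe subtree if for some node $v$ of $T$ the tree $T_v$ can be made isomorphic (as a plane tree) to $T'$ by replacing some or none of its own fringe subtrees with leaves. The complete $r$-ary tree of height $h$ is the plane tree in which all nodes at depth less than $h$ have exactly $r$ children and all nodes at depth $h$ are leaves; so $\overline{H}_{n,r}$ is the largest $h$ such that $\mathcal{T}_n$ contains the complete $r$-ary tree of height $h$ as a non-fringe subtree. The Galton-Watson tree $\mathcal{T}$ is generated from the root by giving each node independently a number of children distributed as $\xi$. With $h_\xi=\gcd\{i\ge1:\mathbb{P}(\xi=i)>0\}$, $\mathbb{P}(|\mathcal{T}|=n)>0$ for all large $n\equiv1\pmod{h_\xi}$, and limits as $n\to\infty$ are along such $n$. *)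

(* Defs.v *)
(* MathComp / MathComp-Analysis *)
From HB Require Import structures.
From mathcomp Require Import all_boot all_order all_algebra.
From mathcomp Require Import all_classical all_reals all_analysis.

Set Implicit Arguments.
Unset Strict Implicit.
Unset Printing Implicit Defensive.

Import Order.TTheory GRing.Theory Num.Theory.
Import numFieldNormedType.Exports.

Local Open Scope classical_set_scope.
Local Open Scope ring_scope.

Inductive ptree : Type := Node of seq ptree.

Definition leaf : ptree := Node [::].

Fixpoint psize (t : ptree) : nat :=
  let: Node ts := t in (sumn (map psize ts)).+1.

(* [fringe t s]: s is the fringe subtree t_v for some node v of t. *)
Inductive fringe : ptree -> ptree -> Prop :=
| fringe_root t : fringe t t
| fringe_child ts i s : (i < size ts)%N ->
    fringe (nth leaf ts i) s -> fringe (Node ts) s.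

(* [prune t t']: t' arises from t by replacing some or none of the fringe
   subtrees of t with leaves.  At each node reached from the root, either the
   whole fringe subtree is replaced ([prune_leaf]) or the node is kept with all
   its children, in order ([prune_node]).  The recursion stops at a childless
   node by either constructor. *)
Inductive prune : ptree -> ptree -> Prop :=
| prune_leaf t : prune t leaf
| prune_node ts ts' : size ts = size ts' ->
    (forall i, (i < size ts)%N -> prune (nth leaf ts i) (nth leaf ts' i)) ->
    prune (Node ts) (Node ts').

Definition nonfringe (t t' : ptree) : Prop :=
  exists2 s, fringe t s & prune s t'.

Fixpoint complete_tree (r h : nat) : ptree :=
  if h is h'.+1 then Node (nseq r (complete_tree r h')) else leaf.

(* The bound [psize t] only serves to make the maximum finite; see
   [max_heightP]. *)
Definition max_height (r : nat) (t : ptree) : nat :=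
  (\max_(h < psize t | `[< nonfringe t (complete_tree r h) >]) h)%N.

(* Nodes are words over nat (Ulam-Harris labels), [rcons u i] being the i-th
   child of u, counted from 0.  [generates d u t] says that giving each node v
   exactly d v children, from u downwards, produces the finite tree t; for a
   given d there is at most one such t, and none if the tree is infinite. *)
Inductive generates (d : seq nat -> nat) : seq nat -> ptree -> Prop :=
| Generates u ts : size ts = d u ->
    (forall i, (i < size ts)%N -> generates d (rcons u i) (nth leaf ts i)) ->
    generates d u (Node ts).

Definition gcd_set (A : set nat) : nat :=
  get [set g : nat | forall d, (d %| g)%N <-> (forall i, A i -> (d %| i)%N)].

Section Probability.
Context d (T : measurableType d) (R : realType) (P : probability T R).

Definition mutually_independent (I : choiceType) d' (T' : measurableType d')
    (X : I -> {RV P >-> T'}) : Prop :=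
  forall (s : seq I) (B : I -> set T'), uniq s ->
    (forall i, measurable (B i)) ->
    P (\bigcap_(i in [set` s]) (X i @^-1` B i)) =
    (\prod_(i <- s) P (X i @^-1` B i))%E.

Definition offspring_span (xi : {RV P >-> nat}) : nat :=
  gcd_set [set i | (1 <= i)%N /\ (0 < P (xi @^-1` [set i]))%E].

(* X u is the number of children of the node labelled u. *)
Definition gw_offspring (xi : {RV P >-> nat})
    (X : seq nat -> {RV P >-> nat}) : Prop :=
  mutually_independent X /\
  forall u (B : set nat), P (X u @^-1` B) = P (xi @^-1` B).

(* The event that the Galton-Watson tree is finite and belongs to A. *)
Definition gw_event (X : seq nat -> {RV P >-> nat}) (A : set ptree) : set T :=
  [set w | exists2 t, generates (fun u => X u w) [::] t & A t].

(* P(T_n \in A), where T_n is the Galton-Watson tree conditioned to have n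
   nodes; the value is 0 for the n with P(|T| = n) = 0. *)
Definition gw_cond (X : seq nat -> {RV P >-> nat}) (n : nat)
    (A : set ptree) : R :=
  fine (P (gw_event X (A `&` [set t | psize t = n]))) /
  fine (P (gw_event X [set t | psize t = n])).

End Probability.

Definition logb (R : realType) (b x : R) : R := ln x / ln b.

Lemma gcd_setP (A : set nat) (d : nat) :
  (d %| gcd_set A)%N <-> (forall i, A i -> (d %| i)%N).
Proof.
suff ex : exists g : nat, forall e,
    (e %| g)%N <-> (forall i, A i -> (e %| i)%N).
  by move: d; exact: (getPex ex).
have [[a Aa a_gt0]|A0] := pselect (exists2 a, A a & (0 < a)%N); last first.
  exists 0%N => e; split=> // _ i Ai.
  by case: i Ai => [|i] Ai; [exact: dvdn0|case: A0; exists i.+1].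
pose cd e := `[< forall i, A i -> (e %| i)%N >].
have cd1 : exists e, cd e by exists 1%N; apply/asboolP => i _; exact: dvd1n.
have cdle e : cd e -> (e <= a)%N by move/asboolP/(_ a Aa); exact: dvdn_leq.
case: (ex_maxnP cd1 cdle) => g /asboolP gA gmax.
exists g => e; split=> [eg i Ai|eA]; first exact: dvdn_trans eg (gA i Ai).
have cdl : cd (lcmn e g) by apply/asboolP => i Ai; rewrite dvdn_lcm eA // gA.
have l_gt0 : (0 < lcmn e g)%N.
  by move/asboolP/(_ a Aa): cdl; case: (lcmn e g) => //; rewrite dvd0n gtn_eqF.
have le_g := gmax _ cdl.
have := dvdn_leq l_gt0 (dvdn_lcmr e g) => ge_g.
have -> : g = lcmn e g by apply/eqP; rewrite eqn_leq le_g ge_g.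
exact: dvdn_lcml.
Qed.

Lemma psize_nth (ts : seq ptree) i : (i < size ts)%N ->
  (psize (nth leaf ts i) <= sumn (map psize ts))%N.
Proof.
elim: ts i => [|t ts IH] [|i] //= lti; first exact: leq_addr.
by apply: leq_trans (IH i lti) _; exact: leq_addl.
Qed.

Lemma fringe_psize t s : fringe t s -> (psize s <= psize t)%N.
Proof.
elim=> // ts i u lti _ IH; apply: (leq_trans IH) => /=.
exact: (leq_trans (psize_nth lti)).
Qed.

Lemma prune_psize t s : prune t s -> (psize s <= psize t)%N.
Proof.
elim=> [[ts] //|ts ts' eqs _ IH] /=; rewrite ltnS.
elim: ts ts' eqs IH => [|t0 ts IHts] [|t0' ts'] //= [eqs] IH.
apply: leq_add; first exact: (IH 0%N).
by apply: IHts => // i lti; exact: (IH i.+1).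
Qed.

Lemma complete_psize r h : (0 < r)%N -> (h < psize (complete_tree r h))%N.
Proof.
move=> r_gt0; elim: h => [|h IH] //=; rewrite ltnS; apply: (leq_trans IH).
by case: r r_gt0 {IH} => //= r _; exact: leq_addr.
Qed.

Lemma max_heightP r t : (0 < r)%N ->
  nonfringe t (complete_tree r (max_height r t)) /\
  forall h, nonfringe t (complete_tree r h) -> (h <= max_height r t)%N.
Proof.
move=> r_gt0; have lth h : nonfringe t (complete_tree r h) -> (h < psize t)%N.
  move=> [s ts sc]; apply: leq_trans (complete_psize h r_gt0) _.
  exact: leq_trans (prune_psize sc) (fringe_psize ts).
have c0 : nonfringe t (complete_tree r 0).
  by exists t; [exact: fringe_root|exact: prune_leaf].
split=> [|h hc]; last first.
  apply: (@leq_bigmax_cond _ _ (@nat_of_ord (psize t)) (Ordinal (lth _ hc))).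
  exact/asboolP.
have [|i ic e] := @eq_bigmax_cond _
    [pred h : 'I_(psize t) | `[< nonfringe t (complete_tree r h) >]]
    (@nat_of_ord _).
  by apply/card_gt0P; exists (Ordinal (lth _ c0)); exact/asboolP.
have -> : max_height r t = i := e.
exact/asboolP.
Qed.

(* Main.v *)
Require Import Defs.
From HB Require Import structures.
From mathcomp Require Import all_boot all_order all_algebra.
From mathcomp Require Import all_classical all_reals all_analysis.
From mathcomp Require Import measurable_realfun ring lra zify.
Import Order.TTheory GRing.Theory Num.Theory.
Import numFieldNormedType.Exports.
Local Open Scope classical_set_scope.
Local Open Scope ring_scope.

(** Read in depth-first order, a plane tree becomes the word of the numbers of
    children of its nodes ([pcode]). Writing [p i] for the probability of [i]
    children, the unconditioned tree equals [t] with probability the product of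
    the [p i] over the letters of [pcode t]. The conditioned tree is therefore
    described by weights of words of length [n], as if the letters were
    independent ([gw_condE]).

    Upper bound. A tree whose root starts a complete [r]-ary tree of height
    [h + 1] has [r ^ h] prescribed nodes with [r] children, which has probability
    at most [p r ^ (r ^ h)] ([wpr_prune_complete]). The word of a fringe subtree
    is a factor of the word of the tree, so that a tree with [n] nodes has such a
    fringe subtree with probability at most [(n + 1) ^ 2 * p r ^ (r ^ h)]
    ([wpr_nonfringe_le]). For [h] close to [(1 + eps) * log_r (log n)] this
    decreases faster than any power of [1 / n], because [r ^ h] is of order
    [(log n) ^ (1 + eps)].

    Lower bound. Conversely, a factor equal to the word of the complete tree is
    the word of a fringe subtree ([factor_fringe]). If the complete tree of
    height [h] has [m] nodes and probability [q], the [n / m] disjoint blocks of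
    a word of length [n] all miss its word with probability at most
    [(1 - q) ^ (n / m)] ([wpr_no_factor]). For [h] close to
    [(1 - eps) * log_r (log n)], both [m] and [1 / q] are [n ^ o(1)], and this
    again decreases faster than any power of [1 / n].

    Conditioning on the size divides these bounds by the probability that the
    tree has [n] nodes, so it remains to see that the latter is at least [c / n ^ 2]
    ([tree_mass_ge]). By the cycle lemma it is at least [1 / n] times the
    probability that the [n] letters sum to [n - 1] ([wpr_pcode_ge]). That
    probability is bounded below without a local limit theorem. By Chebyshev's
    inequality, a word usually has a sum within [O(sqrt n)] of [n] and nearly the
    expected numbers of letters [0] and [r] ([typical_mass]). Turning [j] letters
    [0] into [r], or [r] into [0], shifts the sum by [j * r], and for
    [j = O(sqrt n)] it changes the weight of a set of such words by a bounded
    factor only ([wpr_shift]). Hence every sum near [n] has at least [c / n] times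
    the probability of the usual words in its class modulo [r] ([wpr_transfer]).
    A bounded number of additional letters corrects the class; it can be any
    multiple of the span ([residue_words]), which is why [n] must be 1 modulo the
    span ([local_lower_bound]). *)

Set Implicit Arguments.
Unset Strict Implicit.
Unset Printing Implicit Defensive.

(** * Weighted words *)

(** Bounding the letters makes sums over words finite; the bound [B] is harmless
    because the word of a tree with [n] nodes only has letters below [n]. *)
Fixpoint words (B n : nat) : seq (seq nat) :=
  if n is n'.+1 then [seq i :: u | i <- index_iota 0 B, u <- words B n']
  else [:: [::]].

Lemma mem_words B n u :
  (u \in words B n) = (size u == n) && all (fun i => i < B)%N u.
Proof.
elim: n u => [|n IH] [|i u] //=; first by apply/negbTE/allpairsP => -[[]] /= ? ? [].
apply/allpairsP/idP => [[[j v]] /= [jB vw [-> ->]]|/and3P[su iB au]].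
  by move: jB vw; rewrite mem_index_iota IH eqSS => /= -> /andP[-> ->].
by exists (i, u) => /=; rewrite mem_index_iota IH iB au -eqSS su.
Qed.

Lemma words_uniq B n : uniq (words B n).
Proof.
elim: n => //= n IH; apply: allpairs_uniq => //; first exact: iota_uniq.
by move=> [i u] [j v] _ _ /= [-> ->].
Qed.

Lemma size_words B n : size (words B n) = (B ^ n)%N.
Proof. by elim: n => //= n IH; rewrite size_allpairs IH size_iota subn0 expnS. Qed.

Section WordSums.
Variables (R : realType) (p : nat -> R).
Hypothesis p_ge0 : forall i, 0 <= p i.

Definition wt (u : seq nat) : R := \prod_(i <- u) p i.

(** The expectation of [F] at a word of [n] independent letters, on the event that
    they are all below [B]. *)
Definition wsum B n (F : seq nat -> R) : R :=
  \sum_(u <- words B n) wt u * F u.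

Definition wpr B n (A : set (seq nat)) : R :=
  wsum B n (fun u => (`[< A u >] : bool)%:R).

Lemma wt_ge0 u : 0 <= wt u.
Proof. exact: prodr_ge0. Qed.

Lemma wt_cat u v : wt (u ++ v) = wt u * wt v.
Proof. exact: big_cat. Qed.

Lemma wsum0 B F : wsum B 0 F = F [::].
Proof. by rewrite /wsum /= big_seq1 /wt big_nil mul1r. Qed.

Lemma wsumS B n F :
  wsum B n.+1 F = \sum_(0 <= i < B) p i * wsum B n (fun u => F (i :: u)).
Proof.
rewrite /wsum big_allpairs_dep; apply: eq_bigr => i _; rewrite mulr_sumr.
by apply: eq_bigr => u _; rewrite /wt big_cons mulrA.
Qed.

Lemma wsum_le B n F G :
  (forall u, size u = n -> all (fun i => i < B)%N u -> wt u != 0 -> F u <= G u) ->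
  wsum B n F <= wsum B n G.
Proof.
move=> FG; rewrite /wsum big_seq [leRHS]big_seq; apply: ler_sum => u.
rewrite mem_words => /andP[/eqP su au].
have [->|w0] := eqVneq (wt u) 0; first by rewrite !mul0r.
by rewrite ler_wpM2l ?wt_ge0// FG.
Qed.

Lemma eq_wsum B n F G :
  (forall u, size u = n -> all (fun i => i < B)%N u -> wt u != 0 -> F u = G u) ->
  wsum B n F = wsum B n G.
Proof. by move=> FG; apply/eqP; rewrite eq_le !wsum_le// => u *; rewrite FG. Qed.

Lemma wsum_ge0 B n F : (forall u, 0 <= F u) -> 0 <= wsum B n F.
Proof. by move=> F0; apply: sumr_ge0 => u _; rewrite mulr_ge0 ?wt_ge0. Qed.

Lemma wsumD B n F G :
  wsum B n (fun u => F u + G u) = wsum B n F + wsum B n G.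
Proof. by rewrite /wsum -big_split; apply: eq_bigr => u _; rewrite mulrDr. Qed.

Lemma wsumZ B n a F : wsum B n (fun u => a * F u) = a * wsum B n F.
Proof. by rewrite /wsum mulr_sumr; apply: eq_bigr => u _; rewrite mulrCA. Qed.

Lemma wsumZr B n a F : wsum B n (fun u => F u * a) = wsum B n F * a.
Proof. by rewrite /wsum mulr_suml; apply: eq_bigr => u _; rewrite mulrA. Qed.

Lemma wsum_exchange B n (I : Type) (s : seq I) (F : I -> seq nat -> R) :
  wsum B n (fun u => \sum_(k <- s) F k u) = \sum_(k <- s) wsum B n (F k).
Proof. by rewrite /wsum exchange_big; apply: eq_bigr => u _; rewrite mulr_sumr. Qed.

Lemma wsum_cat B n m F :
  wsum B (n + m) F = wsum B n (fun x => wsum B m (fun y => F (x ++ y))).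
Proof.
elim: n F => [|n IH] F; first by rewrite wsum0.
by rewrite addSn !wsumS; apply: eq_bigr => i _; rewrite IH.
Qed.

Lemma wsum_rot B n k F : (k <= n)%N ->
  wsum B n (fun u => F (rot k u)) = wsum B n F.
Proof.
move=> /subnKC <-; rewrite [in RHS]addnC !wsum_cat.
rewrite (eq_wsum (G := fun x => wsum B (n - k) (fun y => F (y ++ x)))); last first.
  by move=> x sx _ _; apply: eq_wsum => y *; rewrite -sx rot_size_cat.
rewrite /wsum; under eq_bigr do rewrite mulr_sumr.
rewrite exchange_big; apply: eq_bigr => y _; rewrite mulr_sumr.
by apply: eq_bigr => x _; rewrite mulrCA.
Qed.

Lemma wsum_cst B n a : wsum B n (fun=> a) = (\sum_(0 <= i < B) p i) ^+ n * a.
Proof.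
elim: n => [|n IH]; first by rewrite wsum0 mul1r.
by rewrite wsumS; under eq_bigr do rewrite IH; rewrite -mulr_suml exprS mulrA.
Qed.

Lemma wpr_set1 B n v : size v = n -> all (fun i => i < B)%N v ->
  wpr B n [set v] = wt v.
Proof.
move=> sv av; rewrite /wpr /wsum (bigD1_seq v) ?words_uniq//=; last first.
  by rewrite mem_words sv eqxx.
rewrite asboolT// mulr1 big1 ?addr0// => u /eqP uv.
by rewrite asboolF ?mulr0// => /uv.
Qed.

Lemma wpr_ge0 B n A : 0 <= wpr B n A.
Proof. exact: wsum_ge0. Qed.

Lemma wpr_le B n A A' :
  (forall u, size u = n -> all (fun i => i < B)%N u -> wt u != 0 -> A u -> A' u) ->
  wpr B n A <= wpr B n A'.
Proof.
move=> AA; apply: wsum_le => u su au wu.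
have [Au|nAu] := pselect (A u); last by rewrite (asboolF nAu) ler0n.
by rewrite (asboolT (AA _ su au wu Au)) ler_nat leq_b1.
Qed.

Lemma wpr_bigU B n (I : eqType) (s : seq I) (A : I -> set (seq nat)) A' :
  (forall u, size u = n -> all (fun i => i < B)%N u -> wt u != 0 -> A' u ->
     exists2 k, k \in s & A k u) ->
  wpr B n A' <= \sum_(k <- s) wpr B n (A k).
Proof.
move=> AA; rewrite -wsum_exchange; apply: wsum_le => u su au wu.
have [Au|a] := pselect (A' u); last first.
  by rewrite (asboolF a); apply: sumr_ge0 => *; rewrite ler0n.
have [k ks Ak] := AA _ su au wu Au.
rewrite (perm_big _ (perm_to_rem ks))/= big_cons asboolT// asboolT//.
by rewrite lerDl; apply: sumr_ge0 => *; rewrite ler0n.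
Qed.

Lemma wpr_eq0 B n A :
  (forall u, size u = n -> all (fun i => i < B)%N u -> wt u != 0 -> ~ A u) ->
  wpr B n A = 0.
Proof.
move=> A0; apply/eqP; rewrite eq_le wpr_ge0 andbT.
apply: (@le_trans _ _ (wsum B n (fun=> 0))); last by rewrite wsum_cst mulr0.
by apply: wsum_le => u *; rewrite asboolF//; exact: A0.
Qed.

Section Mass.
Variable B : nat.
Let q := \sum_(0 <= i < B) p i.
Hypothesis q_le1 : q <= 1.

Let q_ge0 : 0 <= q.
Proof. exact: sumr_ge0. Qed.

Lemma wsum_cst_le n a : 0 <= a -> wsum B n (fun=> a) <= a.
Proof. by move=> a0; rewrite wsum_cst ler_piMl// exprn_ile1. Qed.

Lemma wsum_le_cst n F a : 0 <= a ->
  (forall u, size u = n -> all (fun i => i < B)%N u -> wt u != 0 -> F u <= a) ->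
  wsum B n F <= a.
Proof. by move=> a0 Fa; apply: le_trans (wsum_cst_le n a0); exact: wsum_le. Qed.

Lemma wpr_le1 n A : wpr B n A <= 1.
Proof. by apply: wsum_le_cst => // u _ _ _; rewrite lern1 leq_b1. Qed.

Lemma wsum_sum_le n (f : nat -> R) (m : R) :
  `|\sum_(0 <= i < B) p i * f i| <= m ->
  `|wsum B n (fun u => \sum_(i <- u) f i)| <= n%:R * m.
Proof.
move=> fm; elim: n => [|n IH]; first by rewrite wsum0 big_nil normr0 mul0r.
rewrite wsumS.
have E i : wsum B n (fun u => \sum_(j <- i :: u) f j) =
    q ^+ n * f i + wsum B n (fun u => \sum_(j <- u) f j).
  by rewrite -wsum_cst -wsumD; apply: eq_wsum => u *; rewrite big_cons.
under eq_bigr => i _ do rewrite E mulrDr.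
rewrite big_split/= -/q -mulr_suml.
under eq_bigr => i _ do rewrite mulrCA.
rewrite -mulr_sumr; apply: (le_trans (ler_normD _ _)).
rewrite !normrM -natr1 mulrDl mul1r addrC; apply: lerD.
  by rewrite (le_trans _ IH)// ler_piMl// ger0_norm.
by rewrite (le_trans _ fm)// ler_piMl// normrX ger0_norm ?exprn_ile1.
Qed.

(** The cross terms have product mean, hence only contribute the square of the
    (small) mean of one letter. *)
Lemma wsum_sqr_sum_le n (f : nat -> R) (m V : R) :
  `|\sum_(0 <= i < B) p i * f i| <= m ->
  \sum_(0 <= i < B) p i * f i ^+ 2 <= V ->
  wsum B n (fun u => (\sum_(i <- u) f i) ^+ 2) <= n%:R * V + (n%:R * m) ^+ 2.
Proof.
move=> fm fV; have m0 : 0 <= m by exact: le_trans fm.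
have V0 : 0 <= V by apply: le_trans fV; apply: sumr_ge0 => i _; rewrite mulr_ge0// sqr_ge0.
elim: n => [|n IH].
  by rewrite wsum0 big_nil expr0n/= mul0r add0r sqr_ge0.
have S1 := wsum_sum_le n fm.
rewrite wsumS.
have E i : wsum B n (fun u => (\sum_(j <- i :: u) f j) ^+ 2) =
    q ^+ n * f i ^+ 2 + f i * 2 * wsum B n (fun u => \sum_(j <- u) f j)
    + wsum B n (fun u => (\sum_(j <- u) f j) ^+ 2).
  rewrite -wsum_cst -wsumZ -!wsumD; apply: eq_wsum => u *.
  by rewrite big_cons; ring.
under eq_bigr => i _ do rewrite E 2!(mulrDr (p i)).
rewrite !big_split/= -/q.
set S := wsum _ _ (fun u => \sum_(i <- u) f i) in S1 *.
set S2 := wsum _ _ _ in IH *.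
have -> : \sum_(0 <= i < B) p i * (q ^+ n * f i ^+ 2) =
   q ^+ n * \sum_(0 <= i < B) p i * f i ^+ 2.
  by rewrite mulr_sumr; apply: eq_bigr => i _; rewrite mulrCA.
have -> : \sum_(0 <= i < B) p i * (f i * 2 * S) =
   2 * ((\sum_(0 <= i < B) p i * f i) * S).
  by rewrite mulr_suml mulr_sumr; apply: eq_bigr => i _; ring.
rewrite -mulr_suml -/q.
have h1 : q ^+ n * (\sum_(0 <= i < B) p i * f i ^+ 2) <= V.
  rewrite (le_trans _ fV)// ler_piMl ?exprn_ile1//.
  by apply: sumr_ge0 => i _; rewrite mulr_ge0// sqr_ge0.
have h2 : (\sum_(0 <= i < B) p i * f i) * S <= m * (n%:R * m).
  by rewrite (le_trans (ler_norm _))// normrM ler_pM.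
have h3 : q * S2 <= n%:R * V + (n%:R * m) ^+ 2.
  rewrite (le_trans _ IH)// ler_piMl//; apply: wsum_ge0 => u; exact: sqr_ge0.
rewrite -natr1; have := sqr_ge0 m; nra.
Qed.

(** Cutting the letters at [B] spoils a zero mean of [f]; this does no harm as long
    as the remaining mean [m] is of order [1 / sqrt n]. *)
Lemma wpr_chebyshev n (f : nat -> R) (m V K : R) : (0 < n)%N -> 0 < K ->
  `|\sum_(0 <= i < B) p i * f i| <= m ->
  \sum_(0 <= i < B) p i * f i ^+ 2 <= V ->
  wpr B n [set u | K * n%:R < (\sum_(i <- u) f i) ^+ 2]
    <= (V + n%:R * m ^+ 2) / K.
Proof.
move=> n0 K0 fm fV; have Kn : 0 < K * n%:R by rewrite mulr_gt0 ?ltr0n.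
rewrite -(ler_pM2l Kn) -wsumZ.
have -> : K * n%:R * ((V + n%:R * m ^+ 2) / K) = n%:R * V + (n%:R * m) ^+ 2.
  by field; rewrite gt_eqF.
apply: le_trans (wsum_sqr_sum_le n fm fV); apply: wsum_le => u _ _ _.
case: asboolP => [/ltW|] ; rewrite ?mulr1 ?mulr0 ?sqr_ge0//.
Qed.

Lemma wsum_mass n : 1 - n%:R * (1 - q) <= wsum B n (fun=> 1).
Proof.
rewrite wsum_cst mulr1 -/q; elim: n => [|n IH]; first by rewrite mul0r subr0.
rewrite exprS -natr1.
have := ler_wpM2l q_ge0 IH; have := mulr_ge0 (ler0n R n) (sqr_ge0 (1 - q)); lra.
Qed.

End Mass.
End WordSums.

(** * Trees as words *)

(** The Lukasiewicz word of a plane tree. *)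
Fixpoint pcode (t : ptree) : seq nat :=
  let: Node ts := t in size ts :: flatten (map pcode ts).

(** The induction principle generated for [ptree], which nests [seq], says nothing
    about the children. *)
Lemma ptree_nth_ind (Q : ptree -> Prop) :
  (forall ts, (forall i, (i < size ts)%N -> Q (nth leaf ts i)) -> Q (Node ts)) ->
  forall t, Q t.
Proof.
move=> IH t; have [n] := ubnP (psize t); elim: n t => // n IHn [ts] /= tn.
apply: IH => i its; apply: IHn; apply: leq_ltn_trans (psize_nth its) _.
by rewrite -ltnS.
Qed.

Lemma forest_ind (Q : ptree -> Prop) (Q' : seq ptree -> Prop) :
  (forall ts, Q' ts -> Q (Node ts)) -> Q' [::] ->
  (forall t ts, Q t -> Q' ts -> Q' (t :: ts)) -> forall t, Q t.
Proof.
move=> Qn Q0 Qc; apply: ptree_nth_ind => ts Qts; apply: Qn.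
elim: ts Qts => [//|t ts IH] Qts; apply: Qc; first exact: (Qts 0%N).
by apply: IH => i its; apply: (Qts i.+1).
Qed.

Lemma size_pcode t : size (pcode t) = psize t.
Proof.
pose Q' ts := size (flatten (map pcode ts)) = sumn (map psize ts).
move: t; apply: (forest_ind (Q' := Q')); rewrite /Q' //=.
- by move=> ts ->.
- by move=> t ts ht hts /=; rewrite size_cat ht hts.
Qed.

Lemma sumn_pcode t : (sumn (pcode t)).+1 = size (pcode t).
Proof.
pose Q' ts := (sumn (flatten (map pcode ts)) + size ts =
  size (flatten (map pcode ts)))%N.
move: t; apply: (forest_ind (Q' := Q')); rewrite /Q' //=.
- by move=> ts <-; rewrite addnC.
- by move=> t ts ht hts; rewrite sumn_cat size_cat -ht -hts /=; lia.
Qed.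

Lemma leq_sumn (i : nat) u : i \in u -> (i <= sumn u)%N.
Proof.
elim: u => //= j u IH; rewrite in_cons => /predU1P[->|/IH]; lia.
Qed.

Lemma pcode_letter t : all (fun i => (i < psize t)%N) (pcode t).
Proof.
by apply/allP => i /leq_sumn; rewrite -size_pcode -sumn_pcode ltnS.
Qed.

Lemma pcode_prefix_free t t' x y :
  pcode t ++ x = pcode t' ++ y -> t = t' /\ x = y.
Proof.
pose Q' ts := forall ts' x y, size ts = size ts' ->
  flatten (map pcode ts) ++ x = flatten (map pcode ts') ++ y -> ts = ts' /\ x = y.
move: t t' x y; apply: (forest_ind (Q' := Q')); rewrite /Q' //=.
- move=> ts IH [ts'] x y /= [sts /(IH _ _ _ sts)[-> ->]]; by [].
- by move=> [|//].
- move=> t ts IH IHs [//|t' ts'] x y /= [sts]; rewrite -!catA.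
  by move=> /IH[-> /(IHs _ _ _ sts)[-> ->]].
Qed.

Lemma pcode_inj : injective pcode.
Proof.
by move=> t t' tt'; case: (@pcode_prefix_free t t' [::] [::]); rewrite ?tt'.
Qed.

Lemma fringe_factor t s : fringe t s -> exists x y, pcode t = x ++ pcode s ++ y.
Proof.
elim=> [{}t|ts i {}s its _ [x [y xy]]]; first by exists [::], [::]; rewrite cats0.
exists (size ts :: flatten (map pcode (take i ts)) ++ x),
  (y ++ flatten (map pcode (drop i.+1 ts))) => /=.
by rewrite -{2}(cat_take_drop i ts) (drop_nth leaf its) map_cat flatten_cat/= xy -!catA.
Qed.

Lemma fringe_at t k : (k < psize t)%N ->
  exists s y, fringe t s /\ drop k (pcode t) = pcode s ++ y.
Proof.
pose Q' ts := forall k, (k < size (flatten (map pcode ts)))%N ->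
  exists i s y, [/\ (i < size ts)%N, fringe (nth leaf ts i) s &
    drop k (flatten (map pcode ts)) = pcode s ++ y].
move: t k; apply: (forest_ind (Q' := Q')); rewrite /Q' //.
- move=> ts IH [|k] kt; first by exists (Node ts), [::]; rewrite cats0 drop0; split => //; exact: fringe_root.
  have /IH[i [s [y [its ts' e]]]] : (k < size (flatten (map pcode ts)))%N.
    by move: kt; rewrite -size_pcode/= ltnS.
  by exists s, y; split => //; exact: fringe_child its _.
- move=> t ts IH IHs k /=; rewrite size_cat drop_cat => kts.
  case: ltnP => kt.
    rewrite size_pcode in kt; have [s [y [f ->]]] := IH _ kt.
    by exists 0%N, s, (y ++ flatten (map pcode ts)); rewrite catA.
  have /IHs[i [s [y [its f ->]]]] : (k - size (pcode t) < size (flatten (map pcode ts)))%N by lia.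
  by exists i.+1, s, y.
Qed.

(** Codes are prefix-free, so an occurrence of [pcode s] inside [pcode t] can only
    be the code of the fringe subtree rooted at the node where it starts. *)
Lemma factor_fringe t s x y : pcode t = x ++ pcode s ++ y -> fringe t s.
Proof.
move=> e; have [|s' [y' [ts' e']]] := @fringe_at t (size x).
  by rewrite -size_pcode e size_cat size_cat size_pcode; case: s {e} => /= ts; lia.
move: e'; rewrite e drop_size_cat// => /pcode_prefix_free[-> _]; exact: ts'.
Qed.

(** * Decoding and the cycle lemma *)

(** The hypothesis says that, at each position of the word, a tree is still to be
    read. *)
Lemma decode_forest k u : (sumn u + k = size u)%N ->
  (forall j, (j < size u)%N -> (j < sumn (take j u) + k)%N) ->
  exists2 ts, size ts = k & flatten (map pcode ts) = u.
Proof.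
elim: u k => [|i u IH] k /= su pos.
  by exists [::] => //; move: su; lia.
case: k su pos => [|k] su pos; first by have := pos 0%N isT.
have [|j ju|ts sts e] := IH (i + k)%N; first lia.
  have /= := pos j.+1; lia.
exists (Node (take i ts) :: drop i ts) => /=.
  by rewrite size_drop; lia.
rewrite size_take_min sts; congr (_ :: _); first lia.
by rewrite -flatten_cat -map_cat cat_take_drop.
Qed.

(** Among the rotations of a word with the right sum, the one that starts where
    the walk with steps [i - 1] first reaches its minimum codes a tree. *)
Lemma rot_pcode u : (sumn u).+1 = size u ->
  exists2 k, (k < size u)%N & exists t, pcode t = rot k u.
Proof.
move=> su; pose n := size u.
have n0 : (0 < n)%N by rewrite /n -su.
pose f (j : 'I_n.+1) : int := (sumn (take j u))%:Z - j%:Z.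
have [i0 _ i0min] := arg_minP f (i0 := ord0) (P := predT) isT.
have ex : exists j, (j <= n)%N && ((sumn (take j u))%:Z - j%:Z == f i0).
  by exists i0; rewrite -ltnS ltn_ord eqxx.
have [k /andP[kn /eqP fk] kmin] := ex_minnP ex.
have lemin j : (j <= n)%N -> (sumn (take k u))%:Z - k%:Z <= (sumn (take j u))%:Z - j%:Z.
  by rewrite -ltnS fk => jn; exact: (i0min (Ordinal jn)).
have ltmin j : (j < k)%N -> (sumn (take k u))%:Z - k%:Z < (sumn (take j u))%:Z - j%:Z.
  move=> jk; have jn : (j <= n)%N by lia.
  rewrite lt_neqAle lemin// andbT.
  by apply: contraTneq jk => e; rewrite -leqNgt kmin// -e fk jn eqxx.
have tot : sumn u = (sumn (take k u) + sumn (drop k u))%N by rewrite -sumn_cat cat_take_drop.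
have := lemin n (leqnn _); rewrite {1}/n take_size.
have := lemin 0%N (leq0n _); rewrite take0 /=.
move=> l0 ln.
have [|j|ts sts e] := @decode_forest 1 (rot k u).
- by rewrite size_rot addn1 -su (perm_sumn (s2 := u)) // perm_rot.
- rewrite size_rot => ju; rewrite /rot take_cat size_drop; case: (ltnP j (size u - k)) => jk.
    have := lemin (k + j)%N; rewrite takeD sumn_cat; lia.
  rewrite sumn_cat.
  rewrite take_takel; last by lia.
  have := ltmin (j - (n - k))%N; rewrite -/n in jk *; lia.
have kt : exists t, pcode t = rot k u.
  by case: ts sts e => [//|t [|//]] _ /= e; exists t; rewrite -e cats0.
move: kn; rewrite leq_eqVlt => /predU1P[kE|kn]; last by exists k.
exists 0%N => //; rewrite rot0; case: kt => t; rewrite kE rot_size => tu.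
by exists t.
Qed.


(** * Complete trees *)

Lemma prune_refl t : prune t t.
Proof. by elim/ptree_nth_ind: t => ts IH; exact: prune_node. Qed.

Lemma prune_completeS r h s : (0 < r)%N -> prune s (complete_tree r h.+1) ->
  exists ts, [/\ s = Node ts, size ts = r &
    forall i, (i < r)%N -> prune (nth leaf ts i) (complete_tree r h)].
Proof.
move=> r0 /=; move e : (Node _) => t' st'; case: st' e => [{}s|ts ts' sts hts [e]].
  by case: r r0.
move: sts hts; rewrite -e size_nseq => sts hts; exists ts; split=> // i ir.
by have := hts i; rewrite nth_nseq ir sts; exact.
Qed.

Lemma prune_complete_mono r h s : (0 < r)%N ->
  prune s (complete_tree r h.+1) -> prune s (complete_tree r h).
Proof.
move=> r0; elim: h s => [|h IH] s; first by move=> _; exact: prune_leaf.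
move=> /(prune_completeS r0)[ts [-> sts hts]]; apply: prune_node.
  by rewrite size_nseq.
by rewrite sts => i ir; rewrite nth_nseq ir; apply: IH; exact: hts.
Qed.

Lemma nonfringe_complete_mono r h k t : (0 < r)%N -> (h <= k)%N ->
  nonfringe t (complete_tree r k) -> nonfringe t (complete_tree r h).
Proof.
move=> r0 /subnK <-; elim: (k - h)%N => // j IH [s ts].
by rewrite addSn => /(prune_complete_mono r0) sj; apply: IH; exists s.
Qed.

Lemma pcode_complete_letters r h :
  all (fun i => (i == 0%N) || (i == r)) (pcode (complete_tree r h)).
Proof.
elim: h => //= h IH; rewrite size_nseq eqxx orbT /=.
by rewrite map_nseq; apply/allP => i /flattenP[u /nseqP[-> _] /(allP IH)].
Qed.

Lemma psize_complete_le r h : (2 <= r)%N ->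
  (psize (complete_tree r h) < 2 * r ^ h)%N.
Proof.
move=> r2; elim: h => //= h IH; rewrite map_nseq sumn_nseq expnS; nia.
Qed.

(** * Weights of words that code trees *)

Section Weights.
Variables (R : realType) (p : nat -> R).
Hypothesis p_ge0 : forall i, 0 <= p i.
Variable B : nat.
Hypothesis q_le1 : \sum_(0 <= i < B) p i <= 1.

(** Half of the cycle lemma: every word with sum one less than its length is a
    rotation of the code of a tree. *)
Lemma wpr_pcode_ge n :
  wpr p B n [set u | (sumn u).+1 = n] <= n%:R * wpr p B n (range pcode).
Proof.
have -> : n%:R * wpr p B n (range pcode) = \sum_(k <- iota 0 n)
    wpr p B n [set u | range pcode (rot k u)].
  transitivity (\sum_(k <- iota 0 n) wpr p B n (range pcode)).
    by rewrite big_const_seq count_predT size_iota iter_addr_0 mulr_natl.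
  apply: eq_big_seq => k; rewrite mem_iota => /andP[_ kn].
  by rewrite /wpr -[LHS](wsum_rot p_ge0 B _ (ltnW kn)).
apply: wpr_bigU => // u su _ _ /= sun.
have [|k ku [t tk]] := rot_pcode (u := u); first by rewrite su.
by exists k; [rewrite mem_iota -su; lia|exists t].
Qed.

Lemma wpr_cat3 k m l A :
  wpr p B (k + (m + l)) [set u | A (take m (drop k u))] <= wpr p B m A.
Proof.
rewrite /wpr wsum_cat; apply: wsum_le_cst => //; first exact: wsum_ge0.
move=> x sx _ _; rewrite wsum_cat; apply: wsum_le => // y sy _ _.
apply: wsum_le_cst => //= z sz _ _.
by rewrite drop_size_cat// take_size_cat.
Qed.

(** Every node of the tree starts a factor of the word that codes its fringe
    subtree; the letters outside this factor have total mass at most 1. *)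
Lemma wpr_nonfringe_le n t' (b : R) :
  (forall m, (m <= n)%N -> wpr p B m (pcode @` [set s | prune s t']) <= b) ->
  wpr p B n (pcode @` [set t | nonfringe t t']) <= (n.+1 ^ 2)%:R * b.
Proof.
move=> hb.
pose I := [seq (k, m) | k <- iota 0 n.+1, m <- iota 0 n.+1].
pose A (i : nat * nat) := [set u : seq nat | size u = n /\ (i.1 + i.2 <= n)%N /\
  (pcode @` [set s | prune s t']) (take i.2 (drop i.1 u))].
apply: (@le_trans _ _ (\sum_(i <- I) wpr p B n (A i))).
  apply: wpr_bigU => // u su _ _ [t [s /fringe_factor[x [y e]] st] tu].
  exists (size x, size (pcode s)).
    rewrite /I; apply/allpairsP; exists (size x, size (pcode s)).
    rewrite !mem_iota /= -su -tu e !size_cat; split=> //; lia.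
  rewrite /A/= -tu e !size_cat drop_size_cat// take_size_cat//.
  rewrite -su -tu e !size_cat; split => //; split; [lia|by exists s].
have -> : (n.+1 ^ 2)%:R * b = \sum_(i <- I) b.
  by rewrite big_const_seq count_predT size_allpairs size_iota iter_addr_0 mulr_natl.
rewrite big_seq [leRHS]big_seq; apply: ler_sum => -[k m].
move=> /allpairsP[[k' m'] [_ m's [-> ->]]].
have mn : (m' <= n)%N by move: m's; rewrite mem_iota /=; lia.
have [kmn|kmn] := leqP (k' + m') n; last first.
  apply: (@le_trans _ _ 0); last by apply: le_trans (hb m' _); [exact: wpr_ge0|].
  by rewrite wpr_eq0// => u _ _ _; rewrite /A/= => -[_ []]; lia.
apply: le_trans (hb m' mn).
have -> : n = (k' + (m' + (n - k' - m')))%N by lia.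
apply: le_trans (wpr_cat3 k' m' (n - k' - m') _).
by apply: wpr_le => // u _ _ _ [_ []].
Qed.

(** Disjoint blocks of a word match a given word independently. *)
Lemma wpr_no_factor (c : seq nat) N l :
  all (fun i => i < B)%N c ->
  wpr p B (N * size c + l) [set u | forall x y, u <> x ++ c ++ y]
    <= (1 - wt p c) ^+ N.
Proof.
move=> cB; elim: N => [|N IH].
  by rewrite expr0 wpr_le1.
have q0 : 0 <= \sum_(0 <= i < B) p i by exact: sumr_ge0.
rewrite mulSn -addnA /wpr wsum_cat exprS.
apply: (@le_trans _ _ (wsum p B (size c) (fun x =>
   (1 - (`[< [set c] x >] : bool)%:R) * (1 - wt p c) ^+ N))).
  apply: wsum_le => // x sx _ _.
  have [xc|xc] := pselect (x = c).
    rewrite asboolT//= subrr mul0r; apply: wsum_le_cst => // y _ _ _.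
    by rewrite asboolF// => /(_ [::] y); rewrite xc; apply.
  rewrite asboolF//= subr0 mul1r; apply: le_trans IH; apply: wpr_le => // y _ _ _ /=.
  by move=> h x' y' e; apply: (h (x ++ x') y'); rewrite e !catA.
have N0 : 0 <= (1 - wt p c) ^+ N by exact: le_trans (wpr_ge0 p_ge0 _ _ _) IH.
rewrite wsumZr ler_wpM2r//.
have -> : (fun x : seq nat => 1 - (`[< [set c] x >] : bool)%:R) =
  (fun x => 1 + (-1) * (`[< [set c] x >] : bool)%:R : R).
  by apply/funext => x; rewrite mulN1r.
rewrite wsumD wsumZ [X in _ + _ * X](wpr_set1 p erefl cB) mulN1r lerD2r.
by rewrite wsum_cst mulr1 exprn_ile1.
Qed.

End Weights.


(** * Exchanging letters *)

Section Swap.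
Variables (R : realType) (p : nat -> R).
Hypothesis p_ge0 : forall i, 0 <= p i.
Variables (B a b : nat).
Hypotheses (ab : a != b) (aB : (a < B)%N) (bB : (b < B)%N).

Local Notation cnt c u := (count_mem (c : nat) u).

Lemma sum_letter c (F : nat -> R) : (c < B)%N ->
  \sum_(0 <= i < B) p i * ((i == c)%:R * F i) = p c * F c.
Proof.
move=> cB; rewrite (bigD1_seq c) ?mem_index_iota ?iota_uniq//= eqxx mul1r.
by rewrite big1 ?addr0// => i /negPf ->; rewrite mul0r mulr0.
Qed.

(** Changing one letter [a] into [b] is a bijection between words with a marked
    [a] and words with a marked [b]; it multiplies the weight by [p b / p a]. *)
Lemma wsum_swap n (Phi : nat -> nat -> nat -> R) :
  p b * wsum p B n (fun u =>
    (cnt a u)%:R * Phi (sumn u + b)%N (cnt a u) (cnt b u).+1) =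
  p a * wsum p B n (fun u =>
    (cnt b u)%:R * Phi (sumn u + a)%N (cnt a u).+1 (cnt b u)).
Proof.
elim: n Phi => [|n IH] Phi; first by rewrite !wsum0 /= !mul0r !mulr0.
rewrite !wsumS.
pose Ph i s x y := Phi (i + s)%N ((i == a) + x)%N ((i == b) + y)%N.
have EL i : wsum p B n (fun u => (cnt a (i :: u))%:R *
     Phi (sumn (i :: u) + b)%N (cnt a (i :: u)) (cnt b (i :: u)).+1) =
   (i == a)%:R * wsum p B n (fun u => Ph i (sumn u + b)%N (cnt a u) (cnt b u).+1)
   + wsum p B n (fun u => (cnt a u)%:R * Ph i (sumn u + b)%N (cnt a u) (cnt b u).+1).
  rewrite -wsumZ -wsumD; apply: eq_wsum => // u _ _ _.
  by rewrite /Ph /= natrD mulrDl addnA addnS.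
have ER i : wsum p B n (fun u => (cnt b (i :: u))%:R *
     Phi (sumn (i :: u) + a)%N (cnt a (i :: u)).+1 (cnt b (i :: u))) =
   (i == b)%:R * wsum p B n (fun u => Ph i (sumn u + a)%N (cnt a u).+1 (cnt b u))
   + wsum p B n (fun u => (cnt b u)%:R * Ph i (sumn u + a)%N (cnt a u).+1 (cnt b u)).
  rewrite -wsumZ -wsumD; apply: eq_wsum => // u _ _ _.
  by rewrite /Ph /= natrD mulrDl addnA addnS.
under eq_bigr do rewrite EL mulrDr.
under [in RHS]eq_bigr do rewrite ER mulrDr.
rewrite !big_split /= !sum_letter// !mulrDr; congr (_ + _).
  rewrite mulrCA; congr (_ * (_ * _)); apply: eq_wsum => // u _ _ _.
  have ba : (b == a) = false by rewrite eq_sym (negPf ab).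
  by rewrite /Ph !eqxx (negPf ab) ba; congr Phi; lia.
rewrite !mulr_sumr; apply: eq_bigr => i _.
by rewrite mulrCA (IH (Ph i)) mulrCA.
Qed.

(** Dividing by the new number of letters [b] removes the marks from
    [wsum_swap]. *)
Lemma wpr_swap n (Q : nat -> nat -> nat -> Prop) (th : R) : 0 < p a ->
  (forall s x y, Q s x y.+1 -> th * (p a * y.+1%:R) <= p b * x%:R) ->
  th * wpr p B n [set u | Q (sumn u + b)%N (cnt a u) (cnt b u).+1] <=
  wpr p B n [set u | Q (sumn u + a)%N (cnt a u).+1 (cnt b u)].
Proof.
move=> pa0 hQ; rewrite -(ler_pM2l pa0).
pose Phi s x y : R := (`[< Q s x y >] : bool)%:R / y%:R.
apply: (@le_trans _ _ (p b * wsum p B n (fun u =>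
    (cnt a u)%:R * Phi (sumn u + b)%N (cnt a u) (cnt b u).+1))).
  rewrite mulrA /wpr -!wsumZ; apply: wsum_le => // u _ _ _; rewrite /Phi /=.
  case: asboolP => [Qu|_]; last by rewrite !(mulr0, mul0r).
  rewrite !mulr1 mul1r mulrA ler_pdivlMr ?ltr0n// -mulrA mulrCA; exact: hQ Qu.
rewrite wsum_swap ler_pM2l//; apply: wsum_le => // u _ _ _; rewrite /Phi /=.
case: asboolP => [_|_]; last by rewrite mul0r mulr0.
by rewrite mul1r; case: (count _ u) => [|k]; rewrite ?mul0r ?ler01 ?divff.
Qed.

(** Changing [j] letters [a] into [b], one at a time, costs a factor [th] per
    change as long as the ratio of the two letter counts stays close to that of
    their probabilities. *)
Lemma wpr_shift n (G : nat -> nat -> nat -> Prop) (th : R) j s0 s : 0 < p a ->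
  0 <= th ->
  (forall s x y i, G s x y -> (i < j)%N -> (i <= x)%N ->
     th * (p a * (y + i).+1%:R) <= p b * (x - i)%:R) ->
  (s + j * a = s0 + j * b)%N ->
  th ^+ j * wpr p B n [set u | sumn u = s0 /\ G (sumn u) (cnt a u) (cnt b u)]
    <= wpr p B n [set u | sumn u = s].
Proof.
move=> pa0 th0 hG ss0.
pose A i := [set u : seq nat | exists x y, [/\ G s0 x y,
   (sumn u + i * a = s0 + i * b)%N, (cnt a u + i = x)%N & (cnt b u = y + i)%N]].
have step i : (i <= j)%N ->
    th ^+ i * wpr p B n [set u | sumn u = s0 /\ G (sumn u) (cnt a u) (cnt b u)]
    <= wpr p B n (A i).
  elim: i => [|i IH] ij.
    rewrite expr0 mul1r; apply: wpr_le => // u _ _ _ [su Gu].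
    by exists (cnt a u), (cnt b u); rewrite -{1}su; split=> //; lia.
  rewrite exprS -mulrA; apply: le_trans (ler_wpM2l th0 (IH (ltnW ij))) _.
  pose Q t x y := exists x0 y0, [/\ G s0 x0 y0,
    (t + i * a = s0 + i * b + b)%N, (x + i = x0)%N & (y = y0 + i.+1)%N].
  apply: (@le_trans _ _ (th * wpr p B n
      [set u | Q (sumn u + b)%N (cnt a u) (cnt b u).+1])).
    apply: ler_wpM2l => //; apply: wpr_le => // u _ _ _ [x [y [Gxy h1 h2 h3]]].
    by exists x, y; split=> //; lia.
  apply: le_trans (wpr_swap n (Q := Q) pa0 _) _; last first.
    apply: wpr_le => // u _ _ _ [x [y [Gxy h1 h2 h3]]].
    by exists x, y; split=> //; lia.
  move=> t x y [x0 [y0 [Gxy h1 h2 h3]]].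
  have -> : x = (x0 - i)%N by lia.
  have -> : y.+1 = (y0 + i).+1 by lia.
  by apply: hG Gxy ij _; lia.
apply: le_trans (step j (leqnn j)) _; apply: wpr_le => // u _ _ _ [x [y [_ h _ _]]] /=.
lia.
Qed.

End Swap.

(** * A polynomial lower bound for the probability of a given size *)

(** Here [x] and [y] are the numbers of the letters [a] and [b] in a word of
    length [n]. If [pa * y] and [pb * x] are of order [n] and differ by
    [O(sqrt n)], each of the first [O(sqrt n)] changes of [a] into [b] costs a
    factor [1 - O(1 / sqrt n)], hence all of them together a bounded factor. *)
Lemma expR_ratio_bound (R : realType) (pa pb c1 kappa C : R) :
  0 <= pa <= 1 -> 0 < pb <= 1 -> 0 < c1 -> 0 <= kappa -> 0 <= C ->
  exists2 c : R, 0 < c & \forall n \near \oo, exists th : R, [/\ 0 <= th,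
    forall j, j%:R <= C * Num.sqrt n%:R -> c <= th ^+ j &
    forall x y i : nat, c1 * n%:R <= x%:R ->
      `|pa * y%:R - pb * x%:R| <= kappa * Num.sqrt n%:R ->
      i%:R <= C * Num.sqrt n%:R -> (i <= x)%N ->
      th * (pa * (y + i).+1%:R) <= pb * (x - i)%:R].
Proof.
move=> /andP[pa0 pa1] /andP[pb0 pb1] c10 k0 C0.
(* After [i] changes [pa * (y + i).+1] exceeds [pb * (x - i)], which is at least
   [pb * c1 * n / 2], by at most [(kappa + 2 * C + 1) * sqrt n]. *)
pose D := (kappa + 2 * C + 1) * 2 / (pb * c1).
have pc0 : 0 < pb * c1 by rewrite mulr_gt0.
have D0 : 0 <= D by rewrite divr_ge0 ?(ltW pc0)// mulr_ge0//; lra.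
exists (expR (- (D * C))); first exact: expR_gt0.
near=> n; pose s : R := Num.sqrt n%:R.
have s1 : 1 + 2 * C / c1 <= s.
  rewrite -(@ler_pXn2r _ 2) ?nnegrE ?sqrtr_ge0 ?sqr_sqrtr//; last first.
    by rewrite addr_ge0// divr_ge0 ?(ltW c10)// mulr_ge0.
  by near: n; exact: nbhs_infty_ger.
have q0 : 0 <= 2 * C / c1 by rewrite divr_ge0 ?(ltW c10)// mulr_ge0.
have s0 : 0 < s by lra.
have ss : s * s = n%:R by rewrite -expr2 sqr_sqrtr.
exists (expR (- (D / s))); split; first exact: expR_ge0.
- move=> j js; rewrite -expRM_natl ler_expR mulrN lerN2 mulrA ler_pdivrMr//.
  by have := ler_wpM2l D0 js; rewrite -/s; lra.
- move=> x y i xn xy js ix.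
  rewrite expRN mulrC ler_pdivrMr ?expR_gt0//.
  have W0 : 0 <= pb * (x - i)%:R by rewrite mulr_ge0// ltW.
  apply: (@le_trans _ _ (pb * (x - i)%:R * (1 + D / s))); last first.
    by rewrite ler_wpM2l// expR_ge1Dx.
  have h1 : c1 * s * s / 2 <= (x - i)%:R.
    rewrite natrB//.
    have : 2 * C <= c1 * s.
      by rewrite [leRHS]mulrC -ler_pdivrMr//; lra.
    rewrite -ss in xn; rewrite -/s in js => h; have := ler_wpM2r (ltW s0) h; lra.
  have h2 : kappa * s + 2 * i%:R + 1 <= pb * (x - i)%:R * (D / s).
    have -> : pb * (x - i)%:R * (D / s) =
       (kappa + 2 * C + 1) * s * ((x - i)%:R / (c1 * s * s / 2)).
      by rewrite /D; field; rewrite !gt_eqF.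
    have cs0 : 0 < c1 * s * s / 2 by rewrite divr_gt0// !mulr_gt0.
    have h3 : 1 <= (x - i)%:R / (c1 * s * s / 2) by rewrite ler_pdivlMr// mul1r.
    apply: (@le_trans _ _ ((kappa + 2 * C + 1) * s)).
      rewrite -/s in js; nra.
    by rewrite ler_peMr// mulr_ge0// ?ltW//; lra.
  rewrite mulrDr mulr1; apply: le_trans (lerD (lexx _) h2).
  move: xy; rewrite ler_norml => /andP[_]; rewrite -/s natrB// -natr1 natrD => xy.
  have i0 := ler0n R i; nra.
Unshelve. all: by end_near.
Qed.

Lemma sqr_le_norm (R : realType) (z K : R) n : 0 <= K ->
  z ^+ 2 <= K * n%:R -> `|z| <= Num.sqrt K * Num.sqrt n%:R.
Proof. by move=> K0 zK; rewrite -sqrtrM// -sqrtr_sqr ler_wsqrtr. Qed.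

Section LocalBound.
Variables (R : realType) (p : nat -> R) (r : nat) (v : R).
Hypothesis p_ge0 : forall i, 0 <= p i.
Hypothesis q_le1 : forall B, \sum_(0 <= i < B) p i <= 1.
Hypothesis second_moment : forall B, \sum_(0 <= i < B) p i * (i%:R - 1) ^+ 2 <= v.
Hypothesis mean_tail : forall B,
  `|\sum_(0 <= i < B.+1) p i * (i%:R - 1)| * B%:R <= v.
Hypothesis mass_tail : forall B, (1 - \sum_(0 <= i < B.+1) p i) * B%:R ^+ 2 <= v.
Hypotheses (p0_gt0 : 0 < p 0%N) (pr_gt0 : 0 < p r) (r_gt0 : (0 < r)%N).

Local Notation cnt c u := (count_mem (c%N : nat) u).

(** Central limit scale for the sum [s] of a word of length [n] and its numbers [x]
    of letters [0] and [y] of letters [r]. The second condition compares [y] with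
    [x] rather than with [p r * n], as this is what [wpr_shift] needs. *)
Definition typical (K : R) n (s x y : nat) : Prop :=
  [/\ (s%:R - n%:R) ^+ 2 <= K * n%:R,
      (p 0%N * y%:R - p r * x%:R) ^+ 2 <= K * n%:R &
      (x%:R - p 0%N * n%:R) ^+ 2 <= K * n%:R].

Definition typical_word K n : set (seq nat) :=
  [set u | typical K n (sumn u) (cnt 0 u) (cnt r u)].

Let p_le1 i : p i <= 1.
Proof.
rewrite (le_trans _ (q_le1 i.+1))// big_nat_recr//= lerDr; exact: sumr_ge0.
Qed.

Let v_ge0 : 0 <= v.
Proof. by have := second_moment 0; rewrite big_nil. Qed.

Lemma typical_mass : exists2 K : R, 0 <= K & \forall n \near \oo, forall B,
  (n < B)%N -> (r < B)%N -> 2^-1 <= wpr p B n (typical_word K n).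
Proof.
(* The conditions fail with probability at most [(v + v ^+ 2) / K], [1 / K] and
   [(1 + v ^+ 2) / K], and the cut at [B] loses at most 1 / 4. *)
pose K := 4 * (v + 2 * v ^+ 2 + 3).
have v2 : 0 <= v ^+ 2 by exact: sqr_ge0.
have K0 : 0 < K by rewrite /K; have := v_ge0; lra.
exists K; first exact: ltW.
near=> n => B nB rB.
have n0 : (0 < n)%N by near: n; exact: nbhs_infty_gt.
have n0' : 0 < n%:R :> R by rewrite ltr0n.
have n1 : 1 <= n%:R :> R by rewrite ler1n.
have vn : 4 * v <= n%:R by near: n; exact: nbhs_infty_ger.
case: B nB rB => // B nB rB.
have nB' : n%:R <= B%:R :> R by rewrite ler_nat.
have B0 : 0 < B%:R :> R by lra.
pose f1 (i : nat) : R := i%:R - 1.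
pose f2 (i : nat) : R := p 0%N * (i == r)%:R - p r * (i == 0%N)%:R.
pose f3 (i : nat) : R := (i == 0%N)%:R - p 0%N.
have S1 u : \sum_(i <- u) f1 i = (sumn u)%:R - (size u)%:R.
  elim: u => [|i u IH]; first by rewrite big_nil subrr.
  by rewrite big_cons IH /f1 /= natrD -natr1; ring.
have S2 u : \sum_(i <- u) f2 i = p 0%N * (cnt r u)%:R - p r * (cnt 0 u)%:R.
  elim: u => [|i u IH]; first by rewrite big_nil !mulr0 subrr.
  by rewrite big_cons IH /f2 /= !natrD; ring.
have S3 u : \sum_(i <- u) f3 i = (cnt 0 u)%:R - p 0%N * (size u)%:R.
  elim: u => [|i u IH]; first by rewrite big_nil mulr0 subrr.
  by rewrite big_cons IH /f3 /= natrD -natr1; ring.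
have qB := q_le1 B.+1.
set q := \sum_(0 <= i < B.+1) p i in qB.
have mq : 1 - q <= v / n%:R ^+ 2.
  rewrite ler_pdivlMr ?exprn_gt0//; apply: le_trans (mass_tail B).
  by rewrite ler_wpM2l ?subr_ge0// lerXn2r ?nnegrE ?ler0n.
have mq' : 1 - q <= v / n%:R.
  by apply: le_trans mq _; rewrite ler_wpM2l// lef_pV2 ?posrE ?exprn_gt0// ler_eXnr.
have m1 : `|\sum_(0 <= i < B.+1) p i * f1 i| <= v / n%:R.
  by rewrite ler_pdivlMr//; apply: le_trans (mean_tail B); rewrite ler_wpM2l.
have m2 : `|\sum_(0 <= i < B.+1) p i * f2 i| <= 0.
  under eq_bigr => i _ do rewrite /f2 mulrBr mulrCA [X in _ - X]mulrCA.
  rewrite sumrB -!mulr_sumr.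
  have E c : (c < B.+1)%N -> \sum_(0 <= i < B.+1) p i * (i == c)%:R = p c.
    move=> cB; rewrite -[RHS]mulr1 -(sum_letter p (fun=> 1) cB).
    by apply: eq_bigr => i _; rewrite mulr1.
  by rewrite !E// mulrC subrr normr0.
have m3 : `|\sum_(0 <= i < B.+1) p i * f3 i| <= v / n%:R.
  rewrite /f3; under eq_bigr do rewrite mulrBr.
  rewrite sumrB -mulr_suml -/q.
  have -> : \sum_(0 <= i < B.+1) p i * (i == 0%N)%:R = p 0%N.
    rewrite -[RHS]mulr1 -(sum_letter (B := B.+1) p (c := 0) (fun=> 1))//.
    by apply: eq_bigr => i _; rewrite mulr1.
  have -> : p 0%N - q * p 0%N = p 0%N * (1 - q) by ring.
  rewrite ger0_norm ?mulr_ge0 ?subr_ge0//; apply: le_trans mq'.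
  by rewrite ler_piMl ?subr_ge0.
have V1 := second_moment B.+1.
have Vle (f : nat -> R) : (forall i, -1 <= f i <= 1) ->
    \sum_(0 <= i < B.+1) p i * f i ^+ 2 <= 1.
  move=> hf; apply: le_trans qB; apply: ler_sum => i _; rewrite ler_piMr//.
  by have /andP[lo up] := hf i; nra.
have p01 := p_le1 0; have pr1 := p_le1 r.
have p00 := p_ge0 0; have pr0 := p_ge0 r.
have V2 : \sum_(0 <= i < B.+1) p i * f2 i ^+ 2 <= 1.
  by apply: Vle => i; rewrite /f2; case: eqP; case: eqP => _ _ /=; apply/andP; split; lra.
have V3 : \sum_(0 <= i < B.+1) p i * f3 i ^+ 2 <= 1.
  by apply: Vle => i; rewrite /f3; case: eqP => _ /=; apply/andP; split; lra.
have c1 := wpr_chebyshev p_ge0 qB n0 K0 m1 V1.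
have c2 := wpr_chebyshev p_ge0 qB n0 K0 m2 V2.
have c3 := wpr_chebyshev p_ge0 qB n0 K0 m3 V3.
have tot := wsum_mass p_ge0 B.+1 n.
set A1 := [set u | _] in c1; set A2 := [set u | _] in c2; set A3 := [set u | _] in c3.
have union : wsum p B.+1 n (fun=> 1) <= wpr p B.+1 n (typical_word K n) +
    (wpr p B.+1 n A1 + (wpr p B.+1 n A2 + wpr p B.+1 n A3)).
  rewrite -!wsumD; apply: wsum_le => // u su _ _.
  have [u1|u1] := leP ((\sum_(i <- u) f1 i) ^+ 2) (K * n%:R); last first.
    by rewrite [in X in _ + (X + _)]asboolT//; rewrite addrCA lerDl !addr_ge0.
  have [u2|u2] := leP ((\sum_(i <- u) f2 i) ^+ 2) (K * n%:R); last first.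
    by rewrite [in X in _ + (_ + (X + _))]asboolT//; rewrite addrA addrCA lerDl !addr_ge0.
  have [u3|u3] := leP ((\sum_(i <- u) f3 i) ^+ 2) (K * n%:R); last first.
    by rewrite [in X in _ + (_ + (_ + X))]asboolT//; rewrite !addrA lerDr !addr_ge0.
  rewrite asboolT; first by rewrite lerDl !addr_ge0.
  by split; rewrite -?su -?S1 -?S2 -?S3 ?su.
have e1 : n%:R * (v / n%:R) ^+ 2 <= v ^+ 2.
  have -> : n%:R * (v / n%:R) ^+ 2 = v ^+ 2 / n%:R by field; rewrite gt_eqF.
  by rewrite ler_pdivrMr// ler_peMr.
have bad : (v + n%:R * (v / n%:R) ^+ 2) / K + ((1 + n%:R * 0 ^+ 2) / K +
    (1 + n%:R * (v / n%:R) ^+ 2) / K) <= 4^-1.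
  rewrite -!mulrDl ler_pdivrMr// /K expr0n/= mulr0; have := v_ge0; lra.
have e2 : n%:R * (1 - q) <= 4^-1.
  have := ler_wpM2l (ltW n0') mq; rewrite [leRHS]mulrCA => h; apply: le_trans h _.
  have -> : v * (n%:R / n%:R ^+ 2) = v / n%:R by field; rewrite gt_eqF.
  rewrite ler_pdivrMr//; lra.
rewrite -/q in tot; lra.
Unshelve. all: by end_near.
Qed.

Lemma typical_counts (K : R) : 0 <= K -> \forall n \near \oo, forall s x y,
  typical K n s x y ->
  [/\ p 0%N * p r / 4 * n%:R <= x%:R, p 0%N * p r / 4 * n%:R <= y%:R,
   `|s%:R - n%:R| <= Num.sqrt K * Num.sqrt n%:R &
   `|p 0%N * y%:R - p r * x%:R| <= Num.sqrt K * Num.sqrt n%:R].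
Proof.
move=> K0; near=> n => s x y [h1 h2 h3].
have p01 := p_le1 0; have pr1 := p_le1 r.
have pp0 : 0 < p 0%N * p r by rewrite mulr_gt0.
have pp1 : p 0%N * p r <= p 0%N by rewrite ler_piMr// ltW.
have {}h1 := sqr_le_norm K0 h1; have h2' := sqr_le_norm K0 h2.
have {}h3 := sqr_le_norm K0 h3.
have ss : Num.sqrt n%:R * Num.sqrt n%:R = n%:R :> R by rewrite -expr2 sqr_sqrtr.
have hs : 4 * Num.sqrt K / (p 0%N * p r) <= Num.sqrt n%:R.
  rewrite -(@ler_pXn2r _ 2) ?nnegrE ?sqrtr_ge0 ?sqr_sqrtr//; last first.
    by rewrite divr_ge0 ?(ltW pp0)// mulr_ge0// sqrtr_ge0.
  by near: n; exact: nbhs_infty_ger.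
have {}hs : 4 * (Num.sqrt K * Num.sqrt n%:R) <= p 0%N * p r * n%:R.
  rewrite -[in leRHS]ss !mulrA ler_wpM2r ?sqrtr_ge0//.
  by rewrite [leRHS]mulrC -ler_pdivrMr.
have n0 := ler0n R n; have x0 := ler0n R x; have y0 := ler0n R y.
have p00 := p_ge0 0; have pr0 := p_ge0 r.
have hx : p 0%N * n%:R * 3 / 4 <= x%:R.
  move: h3; rewrite ler_norml => /andP[h3 _].
  have := ler_wpM2r n0 pp1; lra.
have hx' := ler_wpM2l pr0 hx.
split=> //.
  have := ler_wpM2r n0 pp1; have := mulr_ge0 p00 n0; lra.
have : p 0%N * y%:R <= y%:R by rewrite ler_piMl.
move: h2'; rewrite ler_norml => /andP[h2' _].
have := mulr_ge0 (ltW pp0) n0; lra.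
Unshelve. all: by end_near.
Qed.

(** A typical sum in the class of [s] is brought to [s] by [O(sqrt n)] changes of
    [0] into [r] or back, at a bounded cost. The factor [n] is a crude count of the
    possible numbers of changes. *)
Lemma wpr_transfer (K : R) (A : nat) : 0 <= K ->
  exists2 c : R, 0 < c & \forall n \near \oo, forall B s,
    (r < B)%N -> `|s%:R - n%:R| <= A%:R :> R ->
    c * wpr p B n (typical_word K n `&` [set u | (sumn u = s %[mod r])%N])
      <= n%:R * wpr p B n [set u | sumn u = s].
Proof.
move=> K0.
pose C : R := Num.sqrt K + A%:R.
have C0 : 0 <= C by rewrite addr_ge0// sqrtr_ge0.
have p01 := p_le1 0; have pr1 := p_le1 r.
have p0g := ltW p0_gt0; have prg := ltW pr_gt0.
have c10 : 0 < p 0%N * p r / 4 by rewrite divr_gt0// mulr_gt0.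
have [||c cp hc] := @expR_ratio_bound R (p 0%N) (p r) (p 0%N * p r / 4)
  (Num.sqrt K) C _ _ c10 (sqrtr_ge0 K) C0; first by rewrite p0g p01.
  by rewrite pr_gt0 pr1.
have [||c' cp' hc'] := @expR_ratio_bound R (p r) (p 0%N) (p 0%N * p r / 4)
  (Num.sqrt K) C _ _ c10 (sqrtr_ge0 K) C0; first by rewrite prg pr1.
  by rewrite p0_gt0 p01.
pose e := Num.min c c'.
have e0 : 0 < e by rewrite lt_min cp cp'.
have ec : e <= c by rewrite ge_min lexx.
have ec' : e <= c' by rewrite ge_min lexx orbT.
exists (e / 4); first by rewrite divr_gt0.
near=> n => B s rB sn.
have [th [th0 thc thr]] : exists th : R, [/\ 0 <= th,
    forall j, j%:R <= C * Num.sqrt n%:R -> c <= th ^+ j &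
    forall x y i : nat, p 0%N * p r / 4 * n%:R <= x%:R ->
      `|p 0%N * y%:R - p r * x%:R| <= Num.sqrt K * Num.sqrt n%:R ->
      i%:R <= C * Num.sqrt n%:R -> (i <= x)%N ->
      th * (p 0%N * (y + i).+1%:R) <= p r * (x - i)%:R].
  by near: n.
have [th' [th'0 thc' thr']] : exists th : R, [/\ 0 <= th,
    forall j, j%:R <= C * Num.sqrt n%:R -> c' <= th ^+ j &
    forall x y i : nat, p 0%N * p r / 4 * n%:R <= x%:R ->
      `|p r * y%:R - p 0%N * x%:R| <= Num.sqrt K * Num.sqrt n%:R ->
      i%:R <= C * Num.sqrt n%:R -> (i <= x)%N ->
      th * (p r * (y + i).+1%:R) <= p 0%N * (x - i)%:R].
  by near: n.
have typ : forall s x y, typical K n s x y ->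
  [/\ p 0%N * p r / 4 * n%:R <= x%:R, p 0%N * p r / 4 * n%:R <= y%:R,
   `|s%:R - n%:R| <= Num.sqrt K * Num.sqrt n%:R &
   `|p 0%N * y%:R - p r * x%:R| <= Num.sqrt K * Num.sqrt n%:R].
  by near: n; exact: (typical_counts K0).
have n1 : 1 <= n%:R :> R by near: n; exact: nbhs_infty_ger.
have s1 : 1 <= Num.sqrt n%:R :> R by rewrite -[X in X <= _]sqrtr1 ler_wsqrtr.
have ss : Num.sqrt n%:R * Num.sqrt n%:R = n%:R :> R by rewrite -expr2 sqr_sqrtr.
have Cs : C * Num.sqrt n%:R <= n%:R.
  rewrite -[leRHS]ss ler_wpM2r ?sqrtr_ge0//.
  rewrite -(@ler_pXn2r _ 2) ?nnegrE ?sqrtr_ge0 ?sqr_sqrtr//.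
  by near: n; exact: nbhs_infty_ger.
(* The number of changes is [O(sqrt n)]. *)
have jC t x y (j : nat) : typical K n t x y -> (t + j * r = s \/ t = s + j * r)%N ->
    j%:R <= C * Num.sqrt n%:R.
  move=> /typ[_ _ ts _] tjs.
  have : j%:R * 1 <= `|t%:R - s%:R| :> R.
    apply: (@le_trans _ _ (j * r)%:R); first by rewrite mulr1 ler_nat leq_pmulr.
    case: tjs => [<-|->]; rewrite natrD.
      by rewrite opprD addNKr normrN ger0_norm.
    by rewrite addrC addKr ger0_norm.
  rewrite mulr1 => jts; apply: le_trans jts _; apply: (@le_trans _ _
    (`|t%:R - n%:R| + `|s%:R - n%:R|)).
    by rewrite -[`|s%:R - _|]normrN opprB (le_trans _ (ler_normD _ _))// addrA subrK.
  rewrite /C mulrDl lerD// (le_trans sn)// ler_peMr//.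
pose E0 j := [set u : seq nat | sumn u = (s - j * r)%N /\
  (typical K n (sumn u) (count_mem 0%N u) (count_mem r u) /\ (sumn u + j * r = s)%N)].
pose E1 j := [set u : seq nat | sumn u = (s + j * r)%N /\
  typical K n (sumn u) (count_mem 0%N u) (count_mem r u)].
have r0 : (0%N != r) by rewrite eq_sym -lt0n.
have B0 : (0 < B)%N by exact: leq_ltn_trans rB.
set W := wpr p B n [set u | sumn u = s].
have W0 : 0 <= W by exact: wpr_ge0.
have H0 j : e * wpr p B n (E0 j) <= W.
  have [jle|jgt] := leP (j%:R : R) (C * Num.sqrt n%:R); last first.
    rewrite wpr_eq0 ?mulr0// => u _ _ _ [_ [t js]].
    by have := jC _ _ _ j t (or_introl js); rewrite leNgt jgt.
  have [sj|sj] := leqP (j * r) s; last first.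
    rewrite wpr_eq0 ?mulr0// => u _ _ _ [_ [_ js]].
    by move: sj; rewrite -js ltnNge leq_addl.
  apply: le_trans (wpr_shift (th := th) (j := j) (s := s) (s0 := (s - j * r)%N) p_ge0 r0 B0 rB
    (G := fun t x y => typical K n t x y /\ (t + j * r = s)%N) n _ _ _ _) => //.
  - by rewrite ler_wpM2r ?wpr_ge0// (le_trans ec)// thc.
  - move=> t x y i [/typ[xn _ _ xy] _] ij ix; apply: thr => //.
    by apply: le_trans jle; rewrite ler_nat ltnW.
  - by rewrite muln0 addn0 subnK.
have H1 j : e * wpr p B n (E1 j) <= W.
  have [jle|jgt] := leP (j%:R : R) (C * Num.sqrt n%:R); last first.
    rewrite wpr_eq0 ?mulr0// => u _ _ _ [js t].
    by have := jC _ _ _ j t (or_intror js); rewrite leNgt jgt.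
  have r0' : r != 0%N by rewrite -lt0n.
  apply: le_trans (wpr_shift (th := th') (j := j) (s := s) (s0 := (s + j * r)%N) p_ge0 r0' rB B0
    (G := fun t y x => typical K n t x y) n _ _ _ _) => //.
  - by rewrite ler_wpM2r ?wpr_ge0// (le_trans ec')// thc'.
  - move=> t x y i /typ[_ xn _ xy] ij ix; apply: thr' => //.
      by rewrite -normrN opprB.
    by apply: le_trans jle; rewrite ler_nat ltnW.
  - by rewrite muln0 addn0.
have : wpr p B n (typical_word K n `&` [set u | (sumn u = s %[mod r])%N]) <=
    \sum_(i <- [seq (b, j) | b <- [:: true; false], j <- iota 0 n.+1])
      wpr p B n (if i.1 then E0 i.2 else E1 i.2).
  apply: wpr_bigU => // u _ _ _ [/= tu us].
  have mj b j : j%:R <= C * Num.sqrt n%:R :> R ->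
      (b, j) \in [seq (b, j) | b <- [:: true; false], j <- iota 0 n.+1].
    move=> jC'; apply/allpairsP; exists (b, j); split => //; first by case: b.
    by rewrite mem_iota leq0n add0n ltnS -(ler_nat R) (le_trans jC').
  have [su|su] := leqP (sumn u) s.
    have rd : (r %| s - sumn u)%N by rewrite -eqn_mod_dvd//; apply/eqP.
    have e1 : (sumn u + (s - sumn u) %/ r * r = s)%N by rewrite divnK// subnKC.
    exists (true, ((s - sumn u) %/ r)%N); last first.
      by split; [rewrite /= divnK// subKn|split].
    by apply: mj; apply: (jC _ _ _ _ tu); left.
  have rd : (r %| sumn u - s)%N by rewrite -(eqn_mod_dvd _ (ltnW su)); apply/eqP.
  have e1 : (sumn u = s + (sumn u - s) %/ r * r)%N by rewrite divnK// subnKC//; exact: ltnW.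
  exists (false, ((sumn u - s) %/ r)%N) => //.
  by apply: mj; apply: (jC _ _ _ _ tu); right.
rewrite big_allpairs_dep big_cons big_seq1 /= => le1.
have le2 (E : nat -> set (seq nat)) : (forall j, e * wpr p B n (E j) <= W) ->
    e * \sum_(j <- iota 0 n.+1) wpr p B n (E j) <= n.+1%:R * W.
  move=> HE; rewrite mulr_sumr.
  have -> : n.+1%:R * W = \sum_(j <- iota 0 n.+1) W.
    by rewrite big_const_seq count_predT size_iota iter_addr_0 mulr_natl.
  by apply: ler_sum.
have := ler_wpM2l (ltW e0) le1; rewrite mulrDr.
have := le2 _ H0; have := le2 _ H1; rewrite -natr1.
have := ler_wpM2r W0 n1; lra.
Unshelve. all: by end_near.
Qed.

Variable g : nat.
Hypothesis g_span : forall e, (e %| g)%N <->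
  (forall i, (1 <= i)%N /\ 0 < p i -> (e %| i)%N).

Let wt_le1 u : wt p u <= 1.
Proof. by apply: prodr_ile1 => i _; rewrite p_ge0 p_le1. Qed.

Lemma wt_gt0P u : 0 < wt p u <-> all (fun i => 0 < p i) u.
Proof.
rewrite /wt; elim: u => [|i u IH]; first by rewrite big_nil ltr01.
rewrite big_cons /=; split => [h|/andP[pi au]]; last by rewrite mulr_gt0//; exact/IH.
have := p_ge0 i; rewrite le_eqVlt => /predU1P[p0|pi].
  by move: h; rewrite -p0 mul0r ltxx.
by rewrite pi; apply/IH; rewrite pmulr_rgt0 in h.
Qed.

Let g_dvd_r : (g %| r)%N.
Proof. by apply: ((g_span g).1 (dvdnn g)); split. Qed.

Let g_dvd_sumn u : wt p u != 0 -> (g %| sumn u)%N.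
Proof.
move=> u0; have {u0} : 0 < wt p u by rewrite lt0r u0 wt_ge0.
move=> /wt_gt0P; elim: u => [|i u IH] /=; first by rewrite dvdn0.
move=> /andP[pi au]; rewrite dvdn_add ?IH//.
by case: i pi => [|i] pi; [rewrite dvdn0|apply: ((g_span g).1 (dvdnn g))].
Qed.

(** The sums modulo [r] of the words of positive weight form a submonoid of a
    finite group, hence the subgroup generated by the span. *)
Lemma span_word : exists2 u, 0 < wt p u & (sumn u = g %[mod r])%N.
Proof.
pose A (z : nat) := exists2 u, 0 < wt p u & (sumn u = z %[mod r])%N.
have AD y z : A y -> A z -> A (y + z)%N.
  move=> [u u0 uy] [w w0 wz]; exists (u ++ w); first by rewrite wt_cat mulr_gt0.
  by rewrite sumn_cat -modnDm uy wz modnDm.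
have A0 : A 0%N by exists [::] => //; rewrite /wt big_nil.
have AM k z : A z -> A (k * z)%N.
  by move=> Az; elim: k => // k IH; rewrite mulSn; exact: AD.
have Ap i : 0 < p i -> A i.
  by move=> pi; exists [:: i]; rewrite ?/wt ?big_seq1//= addn0.
have Amod y z : (y = z %[mod r])%N -> A y -> A z.
  by move=> yz [u u0 uy]; exists u => //; rewrite uy.
have ex : exists z, (0 < z)%N && `[< A z >].
  by exists r; rewrite r_gt0; apply/asboolP; exact: Ap.
have [z /andP[z0 /asboolP Az] zmin] := ex_minnP ex.
(* The remainder of a letter modulo the least positive residue [z] is a residue,
   since subtraction modulo [r] is addition of [r.-1] copies. *)
have zg : (z %| g)%N.
  apply/g_span => i [_ /Ap Ai]; apply/negPn/negP => zi.
  have : A (i %% z)%N.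
    apply: (Amod (i + (r.-1 * (i %/ z)) * z)%N); last by apply: AD => //; exact: AM.
    have -> : (i + r.-1 * (i %/ z) * z = r * (i %/ z * z) + i %% z)%N.
      by rewrite {1}(divn_eq i z) -mulnA -[in RHS](prednK r_gt0) mulSn addnAC.
    by rewrite [(r * _)%N]mulnC modnMDl.
  move=> Ai'; have := zmin (i %% z)%N.
  rewrite lt0n (_ : (i %% z != 0)%N); last by rewrite -/(dvdn z i).
  by rewrite (asboolT Ai') => /(_ isT); rewrite leqNgt ltn_mod z0.
by have := AM (g %/ z)%N z Az; rewrite divnK.
Qed.

(** Copies of the word of [span_word] reach every multiple of the span; letters [0]
    make up for the missing copies, so that all the words have the same length. *)
Lemma residue_words : exists L (A : nat) (c : R), 0 < c /\ forall rho, (g %| rho)%N ->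
  exists u, [/\ size u = L, (sumn u <= A)%N, c <= wt p u & (sumn u = rho %[mod r])%N].
Proof.
have [w w0 wg] := span_word.
pose z := nseq (size w) 0%N.
have wtz : wt p z = p 0%N ^+ size w.
  by rewrite /wt /z big_nseq -Monoid.iteropE.
have z0 : 0 < wt p z by rewrite wtz exprn_gt0.
pose blk k := flatten (nseq k w ++ nseq (r - k) z).
exists (r * size w)%N, (r * sumn w)%N, ((wt p w * wt p z) ^+ r).
split=> [|rho grho]; first by rewrite exprn_gt0 ?mulr_gt0.
have wtE k y : wt p (flatten (nseq k y)) = wt p y ^+ k.
  elim: k => [|k IH]; first by rewrite /wt big_nil.
  by rewrite /= wt_cat IH exprS.
have szE k (y : seq nat) : size (flatten (nseq k y)) = (k * size y)%N.
  by elim: k => //= k IH; rewrite size_cat IH mulSn.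
have smE k (y : seq nat) : sumn (flatten (nseq k y)) = (k * sumn y)%N.
  by elim: k => //= k IH; rewrite sumn_cat IH mulSn.
have sz0 : sumn z = 0%N by rewrite /z sumn_nseq mul0n.
pose k := (rho %/ g %% r)%N; have kr : (k <= r)%N by rewrite ltnW// ltn_mod.
exists (blk k); rewrite /blk flatten_cat; split.
- by rewrite size_cat !szE size_nseq -mulnDl subnKC.
- by rewrite sumn_cat !smE sz0 muln0 addn0 leq_mul2r kr orbT.
- rewrite wt_cat !wtE exprMn ler_pM ?exprn_ge0 ?(ltW w0) ?(ltW z0)//.
    by rewrite ler_wiXn2l ?(ltW w0).
  by rewrite ler_wiXn2l ?(ltW z0)// leq_subr.
- rewrite sumn_cat !smE sz0 muln0 addn0 /k modnMml -modnMmr wg modnMmr divnK//.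
Qed.

(** The typical words of length [n - L], of mass at least 1 / 2, fall into [r]
    residue classes; from each class, suitable last [L] letters lead to the sum
    [n - 1]. *)
Lemma local_lower_bound : exists2 c : R, 0 < c & \forall n \near \oo, forall B,
  (n + r < B)%N -> (n = 1 %[mod g])%N ->
  c <= n%:R * wpr p B n [set u | (sumn u).+1 = n].
Proof.
have [L [A [c1 [c10 suf]]]] := residue_words.
have [K K0 mass] := typical_mass.

have [c c0 tr] := wpr_transfer (A + L).+1 K0.
exists (c1 * c / 2 / r%:R); first by rewrite !(divr_gt0, mulr_gt0)// ltr0n.
near \oo => N0.
have NP N : (N0 <= N)%N -> [/\ forall B, (N < B)%N -> (r < B)%N ->
    2^-1 <= wpr p B N (typical_word K N),
  forall B s, (r < B)%N -> `|s%:R - N%:R| <= (A + L).+1%:R :> R ->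
    c * wpr p B N (typical_word K N `&` [set u | (sumn u = s %[mod r])%N])
      <= N%:R * wpr p B N [set u | sumn u = s] & (A < N)%N].
  move: N; near: N0.
  have [N1 _ h1] := mass; have [N2 _ h2] := tr.
  exists (N1 + N2 + A.+1)%N => // m /= mN N Nm; split.
  - by apply: h1 => /=; clear -mN Nm; lia.
  - by apply: h2 => /=; clear -mN Nm; lia.
  - by clear -mN Nm; lia.
exists (N0 + L)%N => // n /= nN B nB n1.
have [N [nE NN]] : exists N, n = (N + L)%N /\ (N0 <= N)%N.
  by clear -nN; exists (n - L)%N; lia.
have [ms trN AN] := NP _ NN.
have NB : (N < B)%N by clear -nB nE; lia.
have rB : (r < B)%N by clear -nB; lia.
have cc0 : 0 <= c1 * c by rewrite mulr_ge0// ltW.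
set W := wpr p B n _.
have W0 : 0 <= W by exact: wpr_ge0.
have key rho : c1 * c * wpr p B N (typical_word K N `&`
    [set u | (sumn u = rho %[mod r])%N /\ (g %| sumn u)%N]) <= n%:R * W.
  have [grho|grho] := boolP (g %| rho)%N; last first.
    rewrite wpr_eq0 ?mulr0 ?mulr_ge0// => u _ _ _ [_ [ur gu]]; case/negP: grho.
    move: gu; rewrite (divn_eq (sumn u) r) ur dvdn_addr ?dvdn_mull// => gu.
    by rewrite (divn_eq rho r) dvdn_add// dvdn_mull.
  have gn1 : (g %| n.-1)%N.
    have n0 : (0 < n)%N by clear -nE AN; lia.
    by rewrite -subn1 -eqn_mod_dvd//; apply/eqP.
  have [|w [szw smw wtw wr]] := suf (n.-1 + r.-1 * rho)%N.
    by rewrite dvdn_add// dvdn_mull.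
  pose s := (n.-1 - sumn w)%N.
  have sE : (s + sumn w = n.-1)%N by rewrite /s subnK//; clear -smw AN nE; lia.
  have sr : (s = rho %[mod r])%N.
    apply/eqP; rewrite -(eqn_modDr (n.-1 + r.-1 * rho)%N) -modnDmr -wr modnDmr sE.
    have -> : (rho + (n.-1 + r.-1 * rho) = rho * r + n.-1)%N.
      by rewrite addnCA -mulSn prednK// mulnC addnC.
    by rewrite modnMDl.
  have sN : `|s%:R - N%:R| <= (A + L).+1%:R :> R.
    rewrite ler_distl lerBlDr -!natrD !ler_nat; clear -sE nE smw.
    by apply/andP; split; lia.
  have tN := trN B s rB sN.
  have WN : c1 * wpr p B N [set u | sumn u = s] <= W.
    rewrite /W nE /wpr wsum_cat -wsumZ; apply: wsum_le => // x _ _ _.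
    case: asboolP => /= [xs|_]; last first.
      by rewrite mulr0; apply: wsum_ge0 => // u; rewrite ler0n.
    rewrite mulr1; apply: le_trans wtw _.
    have wB : all (fun i => i < B)%N w.
      by apply/allP => i /leq_sumn; clear -smw AN NB; lia.
    rewrite -(wpr_set1 p szw wB); apply: wpr_le => // y _ _ _ -> /=.
    by rewrite sumn_cat xs -nE; clear -sE AN nE; lia.
  have -> : typical_word K N `&` [set u | (sumn u = rho %[mod r])%N /\ (g %| sumn u)%N]
     = typical_word K N `&` [set u | (sumn u = s %[mod r])%N] `&` [set u | (g %| sumn u)%N].
    apply/seteqP; split=> [u [tu [ur gu]]|u [[tu ur] gu]]; split=> //; first split=> //=.
      by rewrite ur sr.
    by split=> //=; rewrite ur sr.
  apply: (@le_trans _ _ (c1 * (c * wpr p B N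
      (typical_word K N `&` [set u | (sumn u = s %[mod r])%N])))).
    by rewrite mulrA; apply: ler_wpM2l => //; apply: wpr_le => // u _ _ _ [].
  apply: (@le_trans _ _ (c1 * (N%:R * wpr p B N [set u | sumn u = s]))).
    by rewrite ler_wpM2l// ltW.
  rewrite mulrCA; apply: ler_pM => //; first by rewrite mulr_ge0 ?wpr_ge0// ltW.
  by rewrite ler_nat nE leq_addr.
have tot : wpr p B N (typical_word K N) <= \sum_(rho <- iota 0 r)
    wpr p B N (typical_word K N `&`
      [set u | (sumn u = rho %[mod r])%N /\ (g %| sumn u)%N]).
  apply: wpr_bigU => // u _ _ wu tu; exists (sumn u %% r)%N.
    by rewrite mem_iota /= add0n ltn_mod.
  by split=> //; split; rewrite /= ?modn_mod//; exact: g_dvd_sumn.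
have rr0 : 0 < r%:R :> R by rewrite ltr0n.
rewrite ler_pdivrMr// ler_pdivrMr//.
have h := ler_wpM2l cc0 (le_trans (ms B NB rB) tot).
have : c1 * c * (\sum_(rho <- iota 0 r) wpr p B N (typical_word K N `&`
      [set u | (sumn u = rho %[mod r])%N /\ (g %| sumn u)%N])) <= n%:R * W * r%:R.
  rewrite mulr_sumr.
  have -> : n%:R * W * r%:R = \sum_(rho <- iota 0 r) (n%:R * W).
    by rewrite big_const_seq count_predT size_iota iter_addr_0 mulr_natr.
  by apply: ler_sum => rho _; exact: key.
lra.
Unshelve. all: by end_near.
Qed.

Lemma tree_mass_ge : exists2 c : R, 0 < c & \forall n \near \oo, forall B,
  (n + r < B)%N -> (n = 1 %[mod g])%N ->
  c <= n%:R ^+ 2 * wpr p B n (range pcode).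
Proof.
have [c c0 hc] := local_lower_bound.
exists c => //; near=> n => B nB n1.
have /(_ B nB n1) h : forall B, (n + r < B)%N -> (n = 1 %[mod g])%N ->
  c <= n%:R * wpr p B n [set u | (sumn u).+1 = n] by near: n.
apply: le_trans h _; rewrite expr2 -mulrA ler_wpM2l// ?ler0n//.
exact: wpr_pcode_ge.
Unshelve. all: by end_near.
Qed.

End LocalBound.

(** * The law of the Galton-Watson tree *)

Section GaltonWatson.
Context d (T : measurableType d) (R : realType) (P : probability T R).
Variables (xi : {RV P >-> nat}) (X : seq nat -> {RV P >-> nat}).
Hypothesis X_offspring : gw_offspring xi X.

Definition offspring_prob (i : nat) : R := fine (P (xi @^-1` [set i])).
Local Notation p := offspring_prob.

Lemma offspring_prob_ge0 i : 0 <= p i.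
Proof. exact: fine_ge0. Qed.

Lemma offspring_probE i : P (xi @^-1` [set i]) = (p i)%:E.
Proof. by rewrite fineK// fin_num_measure//; exact: measurable_funPTI. Qed.

(** Labels relative to the root, in depth-first order, each with its number of
    children. *)
Fixpoint nodes (t : ptree) : seq (seq nat * nat) :=
  let: Node ts := t in ([::], size ts) ::
    flatten [seq [seq (y.1 :: v.1, v.2) | v <- y.2]
            | y <- zip (iota 0 (size ts)) (map nodes ts)].

Lemma nodes_degrees t : unzip2 (nodes t) = pcode t.
Proof.
pose Q' ts := forall j, unzip2 (flatten [seq [seq (y.1 :: v.1, v.2) | v <- y.2]
   | y <- zip (iota j (size ts)) (map nodes ts)]) = flatten (map pcode ts).
move: t; apply: (forest_ind (Q' := Q')); rewrite /Q' //=.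
- by move=> ts /(_ 0%N) ->.
- move=> t ts ht hts j; rewrite -(hts j.+1) /unzip2 map_cat -map_comp; congr (_ ++ _).
  by rewrite -ht.
Qed.

Lemma mem_nodes ts x : x \in nodes (Node ts) ->
  x = ([::], size ts) \/ exists i v, [/\ (i < size ts)%N,
    v \in nodes (nth leaf ts i) & x = (i :: v.1, v.2)].
Proof.
rewrite /= in_cons => /predU1P[|/flattenP[s /mapP[[j ns] yz ->] /mapP[v vn ->]]].
  by left.
right; move: yz; set z := zip _ _ => yz.
have sz : size z = size ts by rewrite size_zip size_iota size_map minnn.
have := index_mem (j, ns) z; rewrite yz sz => its.
have := nth_index (0%N, nodes leaf) yz.
rewrite nth_zip ?size_map ?size_iota// nth_iota// add0n (nth_map leaf)// => -[jE nsE].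
exists j, v; rewrite /= in vn *; rewrite -jE; split=> //.
by rewrite nsE.
Qed.

Lemma nodes_uniq t : uniq (unzip1 (nodes t)).
Proof.
pose Q' ts := forall j, uniq (unzip1 (flatten [seq [seq (y.1 :: v.1, v.2) | v <- y.2]
   | y <- zip (iota j (size ts)) (map nodes ts)])) /\
  all (fun v => if v is i :: _ then j <= i else false)%N
  (unzip1 (flatten [seq [seq (y.1 :: v.1, v.2) | v <- y.2]
   | y <- zip (iota j (size ts)) (map nodes ts)])).
move: t; apply: (forest_ind (Q' := Q')); rewrite /Q' //=.
- move=> ts /(_ 0%N)[-> h]; rewrite andbT; apply/negP => /(allP h). by [].
- move=> t ts ht hts j; rewrite /unzip1 map_cat -map_comp.
  have [hu ha] := hts j.+1; split.
    rewrite cat_uniq hu andbT; apply/andP; split.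
      rewrite (_ : map _ _ = map (cons j) (unzip1 (nodes t))).
        by rewrite map_inj_uniq// => x y [].
      by rewrite /unzip1 -map_comp.
    apply/hasPn => v /(allP ha); apply: contraTN => /mapP[x _ ->] /=; lia.
  rewrite all_cat; apply/andP; split; first by apply/allP => v /mapP[x _ ->] /=.
  by apply: sub_all ha => -[//|i v]; exact: ltnW.
Qed.

Lemma generatesP (D : seq nat -> nat) u t :
  generates D u t <-> (forall x, x \in nodes t -> D (u ++ x.1) = x.2).
Proof.
split.
- elim=> {}u ts su _ IH x /mem_nodes[->|[i [v [its vn ->]]]] /=.
    by rewrite cats0.
  by rewrite -cat_rcons; exact: IH.
- elim/ptree_nth_ind: t u => ts IH u h; apply: Generates.
    by have := h ([::], size ts); rewrite /= cats0 mem_head => ->.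
  move=> i its; apply: IH => // v vn; rewrite cat_rcons.
  apply: (h (i :: v.1, v.2)); rewrite /= in_cons; apply/orP; right.
  apply/flattenP; exists [seq (i :: w.1, w.2) | w <- nodes (nth leaf ts i)].
    apply/mapP; exists (i, nodes (nth leaf ts i)) => //.
    have -> : (i, nodes (nth leaf ts i)) =
      nth (0%N, nodes leaf) (zip (iota 0 (size ts)) (map nodes ts)) i.
      by rewrite nth_zip ?size_map ?size_iota// nth_iota// (nth_map leaf).
    by rewrite mem_nth// size_zip size_iota size_map minnn.
  by apply/mapP; exists v.
Qed.

Lemma generates_inv (D : seq nat -> nat) u ts : generates D u (Node ts) ->
  size ts = D u /\
  forall i, (i < size ts)%N -> generates D (rcons u i) (nth leaf ts i).
Proof. by move e : (Node ts) => t g; case: g e => {}u ts' sts h [->]. Qed.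

Lemma generates_inj (D : seq nat -> nat) u t t' :
  generates D u t -> generates D u t' -> t = t'.
Proof.
move=> g; elim: g t' => {}u ts su _ IH [ts'] g'.
have [su' h'] := generates_inv g'.
congr Node; apply: (@eq_from_nth _ leaf) => [|i its]; first by rewrite su su'.
by apply: IH => //; apply: h'; rewrite su' -su.
Qed.

Lemma measurable_labels (s : seq (seq nat)) (B : seq nat -> set nat) :
  measurable (\bigcap_(v in [set` s]) (X v @^-1` B v)).
Proof.
apply: fin_bigcap_measurable => // v _; exact: measurable_funPTI.
Qed.

(** The degrees at the nodes are independent, and a finite tree is generated
    precisely when each of its nodes receives its own number of children. *)
Lemma gw_event_set1 t :
  measurable (gw_event X [set t]) /\
  P (gw_event X [set t]) = (wt p (pcode t))%:E.
Proof.
pose B v := [set k : nat | (v, k) \in nodes t].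
have -> : gw_event X [set t] =
    \bigcap_(v in [set` unzip1 (nodes t)]) (X v @^-1` B v).
  apply/seteqP; split => [w [t' /generatesP g /= tt'] v /= /mapP[x xt ->]|w h].
    rewrite tt' in g.
    by have /= gx := g x xt; rewrite /B/= gx -surjective_pairing.
  exists t => //; apply/generatesP => x xt.
  have /h : [set` unzip1 (nodes t)] x.1 by apply/mapP; exists x.
  rewrite /B/= => xt'.
  have := nodes_uniq t; elim: (nodes t) xt xt' => //= y s IH.
  rewrite !in_cons => /predU1P[->|xs] /predU1P[e|xs'] /andP[ys us].
  - by rewrite -e.
  - by case/negP: ys; apply/mapP; exists (y.1, X y.1 w).
  - by case/negP: ys; rewrite -e /=; apply/mapP; exists x.
  - exact: IH.
split; first exact: measurable_labels.
have [ind law] := X_offspring.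
rewrite ind ?nodes_uniq//; last first.
rewrite /wt -nodes_degrees !big_map -prodEFin.
apply: eq_big_seq => x xt; rewrite law -offspring_probE.
congr (P (xi @^-1` _)); apply/seteqP; split => [k|k ->]; last first.
  by rewrite /B/= -surjective_pairing.
rewrite /B/= => xt'.
have := nodes_uniq t; elim: (nodes t) xt xt' => //= y s IH.
rewrite !in_cons => /predU1P[->|xs] /predU1P[e|xs'] /andP[ys us].
- by rewrite -e.
- by case/negP: ys; apply/mapP; exists (y.1, k).
- by case/negP: ys; rewrite -e /=; apply/mapP; exists x.
- exact: IH.
Qed.

(** The size and the word determine the tree, so that the event is the disjoint
    union of finitely many events of [gw_event_set1]. *)
Lemma gw_event_size n (A : set ptree) B : (n <= B)%N ->
  measurable (gw_event X (A `&` [set t | psize t = n])) /\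
  P (gw_event X (A `&` [set t | psize t = n])) = (wpr p B n (pcode @` A))%:E.
Proof.
move=> nB.
pose F u := gw_event X (A `&` [set t | pcode t = u]).
have FE : gw_event X (A `&` [set t | psize t = n]) =
    \bigcup_(u in [set` words B n]) F u.
  apply/seteqP; split => [w [t g [At /= tn]]|w [u /= un [t g [At /= tu]]]].
    exists (pcode t); last by exists t.
    rewrite /= mem_words size_pcode tn eqxx /=.
    by apply: sub_all (pcode_letter t) => i; rewrite tn => /leq_trans; apply.
  exists t => //; split => //=.
  by move: un; rewrite mem_words -tu size_pcode => /andP[/eqP].
have mF u : measurable (F u) /\
    P (F u) = (wt p u * (`[< (pcode @` A) u >] : bool)%:R)%:E.
  have [[t At tu]|nA] := pselect ((pcode @` A) u).
    have -> : F u = gw_event X [set t].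
      apply/seteqP; split => [w [t' g [_ /=]]|w [t' g /= tt']].
        by rewrite -tu => /pcode_inj <-; exists t'.
      by rewrite tt' in g; exists t.
    rewrite asboolT ?mulr1; last by exists t.
    by rewrite -tu; exact: gw_event_set1.
  have -> : F u = set0.
    by rewrite -subset0 => w [t' g [At' /= tu]]; apply: nA; exists t'.
  by rewrite measure0 asboolF// mulr0.
have fw : finite_set [set` words B n] by exact: finite_seq.
rewrite FE; split; first by apply: fin_bigcup_measurable => // u _; exact: (mF u).1.
rewrite measure_fin_bigcup//; last 2 first.
- move=> u v _ _ [w [[t g [_ /= <-]] [t' g' [_ /= <-]]]].
  by rewrite (generates_inj g g').
- by move=> u _; exact: (mF u).1.
rewrite -fsbig_seq ?words_uniq// /wpr /wsum -sumEFin.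
by apply: eq_bigr => u _; exact: (mF u).2.
Qed.

Lemma generates_complete r h (D : seq nat -> nat) u t v : (0 < r)%N ->
  generates D u t -> prune t (complete_tree r h.+1) -> v \in words r h ->
  D (u ++ v) = r.
Proof.
move=> r0; elim: h u t v => [|h IH] u t v g.
  move=> /(prune_completeS r0)[ts [tE sts _]]; rewrite inE => /eqP ->.
  by move: g; rewrite cats0 tE => /generates_inv[<- _].
move=> /(prune_completeS r0)[ts [tE sts hts]].
case: v => [|i v]; first by rewrite mem_words.
rewrite mem_words /= eqSS => /and3P[sv ir av].
rewrite -cat_rcons; apply: (IH _ (nth leaf ts i)).
- by move: g; rewrite tE => /generates_inv[_]; apply; rewrite sts.
- exact: hts.
- by rewrite mem_words sv av.
Qed.

(** At depth [h] a complete tree of height [h.+1] has [r ^ h] nodes, each of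
    which must independently receive exactly [r] children. *)
Lemma wpr_prune_complete r h m B : (0 < r)%N -> (m <= B)%N ->
  wpr p B m (pcode @` [set s | prune s (complete_tree r h.+1)]) <= p r ^+ (r ^ h).
Proof.
move=> r0 mB; rewrite -lee_fin.
have [mE <-] := gw_event_size [set s | prune s (complete_tree r h.+1)] mB.
have [ind law] := X_offspring.
apply: (@le_trans _ _ (P (\bigcap_(v in [set` words r h]) (X v @^-1` [set r])))).
  apply: le_measure; rewrite ?inE//; first exact: measurable_labels.
  by move=> w [t g [pt _]] v /=; exact: (generates_complete (u := [::]) r0 g pt).
rewrite (ind _ (fun=> [set r])) ?words_uniq//.
under eq_bigr do rewrite law offspring_probE.
by rewrite prodEFin big_const_seq count_predT size_words -Monoid.iteropE lexx.
Qed.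

End GaltonWatson.

(** * Moments of the offspring distribution *)

Section OffspringMoments.
Context d (T : measurableType d) (R : realType) (P : probability T R).
Variable xi : {RV P >-> nat}.
Local Notation p := (offspring_prob xi).

Let J (F : nat -> R) : \bar R := (\int[P]_w (F (xi w))%:E)%E.

Let mJ (F : nat -> R) : measurable_fun [set: T] (fun w => (F (xi w))%:E).
Proof.
apply/measurable_EFinP; apply: (@measurableT_comp _ _ _ _ _ _ F) => //.
Qed.

Let JD (F G : nat -> R) : (forall i, 0 <= F i) -> (forall i, 0 <= G i) ->
  J (fun i => F i + G i) = (J F + J G)%E.
Proof.
by move=> F0 G0; rewrite /J -ge0_integralD//; do ?[exact: mJ|move=> w _; rewrite lee_fin].
Qed.

Let JZ k (F : nat -> R) : 0 <= k -> (forall i, 0 <= F i) ->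
  J (fun i => k * F i) = (k%:E * J F)%E.
Proof.
move=> k0 F0; by rewrite /J -ge0_integralZl_EFin//; do ?[exact: mJ|move=> w _; rewrite lee_fin].
Qed.

Let J_le (F G : nat -> R) : (forall i, 0 <= F i) -> (forall i, F i <= G i) ->
  (J F <= J G)%E.
Proof.
move=> F0 FG; apply: ge0_le_integral => //; do ?[exact: mJ|by move=> w _; rewrite lee_fin].
Qed.

Let J_cst k : J (fun=> k) = k%:E.
Proof. by rewrite /J integral_cst//= probability_setT mule1. Qed.

Let mem_fiber k w : (w \in xi @^-1` [set k]) = (xi w == k).
Proof. by apply/idP/eqP; rewrite inE. Qed.

Let J_sum B (a : nat -> R) : (forall i, 0 <= a i) ->
  J (fun k => if (k < B)%N then a k else 0) = (\sum_(0 <= i < B) p i * a i)%:E.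
Proof.
move=> a0.
have -> : (fun k => if (k < B)%N then a k else 0) =
    (fun k => \sum_(0 <= i < B) a i * (k == i)%:R).
  apply/funext => k; case: ltnP => kB.
    rewrite (bigD1_seq k) ?mem_index_iota ?iota_uniq//= eqxx mulr1 big1 ?addr0// => i.
    by rewrite eq_sym => /negPf ->; rewrite mulr0.
  rewrite big_nat big1// => i /andP[_ iB].
  by rewrite gtn_eqF ?mulr0// (leq_trans iB).
elim: B => [|B IH].
  rewrite big_nil -J_cst; congr J; apply/funext => k; by rewrite big_nil.
rewrite big_nat_recr//= EFinD -IH.
under [in LHS]eq_fun do rewrite big_nat_recr//=.
rewrite JD; last 2 first.
- by move=> k; apply: sumr_ge0 => i _; rewrite mulr_ge0// ler0n.
- by move=> k; rewrite mulr_ge0// ler0n.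
congr (_ + _)%E; rewrite JZ// EFinM.
rewrite muleC -offspring_probE; congr (_ * _)%E.
rewrite /J -[in RHS](setIT (xi @^-1` [set B])) -integral_indic//; last exact: measurable_funPTI.
by apply: eq_integral => w _; rewrite indicE mem_fiber.
Qed.

Lemma offspring_mass_le1 B : \sum_(0 <= i < B) p i <= 1.
Proof.
rewrite -lee_fin -(J_cst 1); under eq_bigr do rewrite -[p _]mulr1.
by rewrite -(J_sum _ (a := fun=> 1))//; apply: J_le => i; case: ifP.
Qed.

Hypothesis xi_mean : ('E_P[fun w : T => (xi w)%:R : R] = 1)%E.

Let J_id : J (fun i => i%:R) = 1%E.
Proof. by rewrite -xi_mean unlock. Qed.

Hypothesis xi_var : ('V_P[fun w : T => (xi w)%:R : R] < +oo)%E.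

Definition offspring_var : R := fine ('V_P[fun w : T => (xi w)%:R : R])%E.
Local Notation v := offspring_var.

Let J_sqr : J (fun i => (i%:R - 1) ^+ 2) = v%:E.
Proof.
have E : 'V_P[fun w : T => (xi w)%:R : R]%E = J (fun i => (i%:R - 1) ^+ 2).
  rewrite /variance unlock xi_mean unlock /=; apply: eq_integral => w _.
  by rewrite /= expr2.
rewrite /offspring_var -E fineK// ge0_fin_numE// E.
by apply: integral_ge0 => w _; rewrite lee_fin sqr_ge0.
Qed.

Lemma offspring_second_moment B : \sum_(0 <= i < B) p i * (i%:R - 1) ^+ 2 <= v.
Proof.
rewrite -lee_fin -J_sqr -(J_sum _ (a := fun i => (i%:R - 1) ^+ 2)); last first.
  by move=> i; exact: sqr_ge0.
by apply: J_le => i; case: ifP => _; rewrite ?sqr_ge0.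
Qed.

Lemma offspring_mass_tail B :
  (1 - \sum_(0 <= i < B.+1) p i) * B%:R ^+ 2 <= v.
Proof.
have B2 : 0 <= B%:R ^+ 2 :> R by exact: sqr_ge0.
suff : B%:R ^+ 2 <= \sum_(0 <= i < B.+1) p i * B%:R ^+ 2 + v.
  by rewrite -mulr_suml; lra.
rewrite -lee_fin EFinD -J_sqr -(J_sum _ (a := fun=> B%:R ^+ 2))// -JD; last 2 first.
- by move=> i; case: ifP.
- by move=> i; exact: sqr_ge0.
rewrite -J_cst; apply: J_le => // i; case: ltnP => iB; first by rewrite lerDl sqr_ge0.
rewrite add0r lerXn2r ?nnegrE ?ler0n//.
  by rewrite subr_ge0 ler1n (leq_trans _ iB).
by rewrite lerBrDr natr1 ler_nat.
Qed.

(** As the mean is 1, the mean of [xi - 1] over the values up to [B] is the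
    opposite of its mean over the larger values, where
    [B * (xi - 1) <= (xi - 1) ^+ 2]. *)
Lemma offspring_mean_tail B :
  `|\sum_(0 <= i < B.+1) p i * (i%:R - 1)| * B%:R <= v.
Proof.
have -> : \sum_(0 <= i < B.+1) p i * (i%:R - 1) =
    \sum_(0 <= i < B.+1) p i * i%:R - \sum_(0 <= i < B.+1) p i * 1.
  by rewrite -sumrB; apply: eq_bigr => i _; rewrite mulrBr.
set m := \sum_(_ <= _ < _) _ * _%:R; set q := \sum_(_ <= _ < _) _ * 1.
have Jm : J (fun k => if (k < B.+1)%N then k%:R else 0) = m%:E.
  by rewrite (J_sum _ (a := fun i => i%:R)).
have Jq : J (fun k => if (k < B.+1)%N then 1 else 0) = q%:E.
  by rewrite (J_sum _ (a := fun i => 1)).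
have B0 : 0 <= B%:R :> R by [].
have mq : m <= q.
  suff : (1 + m%:E <= 1 + q%:E)%E by rewrite -!EFinD lee_fin lerD2l.
  rewrite -Jm -Jq -{1}(J_cst 1) -J_id -!JD//; do ?by move=> i; case: ifP.
  apply: J_le => i; first by case: ifP => _; rewrite addr_ge0.
  by case: ltnP => iB; rewrite ?addr0 1?addrC// ler1n (leq_trans _ iB).
have qm : B%:R + B%:R * q <= B%:R * m + B%:R + v.
  have i0 k a : 0 <= a -> 0 <= (if (k < B.+1)%N then a else 0) :> R by case: ifP.
  rewrite -lee_fin.
  have -> : (B%:R + B%:R * q)%:E =
      J (fun k => B%:R * k%:R + B%:R * (if (k < B.+1)%N then 1 else 0)).
    rewrite JD; [|by move=> k; rewrite mulr_ge0|by move=> k; rewrite mulr_ge0// i0].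
    rewrite !JZ//; [|by move=> k; rewrite i0].
    by rewrite J_id Jq mule1 -EFinM -EFinD.
  have -> : (B%:R * m + B%:R + v)%:E =
      J (fun k => B%:R * (if (k < B.+1)%N then k%:R else 0) + B%:R + (k%:R - 1) ^+ 2).
    rewrite JD; [|by move=> k; rewrite addr_ge0// mulr_ge0// i0|
      by move=> k; exact: sqr_ge0].
    rewrite JD//; [|by move=> k; rewrite mulr_ge0// i0].
    rewrite JZ//; [|by move=> k; rewrite i0].
    by rewrite Jm J_sqr J_cst -EFinM -!EFinD.
  apply: J_le => i; first by case: ifP => _; rewrite addr_ge0 ?mulr_ge0.
  case: ltnP => iB; rewrite ?mulr1 ?mulr0 ?add0r ?addr0.
    by rewrite lerDl sqr_ge0.
  have iB' : B%:R + 1 <= i%:R :> R by rewrite natr1 ler_nat.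
  nra.
rewrite ler0_norm ?subr_le0//; lra.
Qed.

(** [xi - 1] has mean 0 and is positive where [xi = r], so it must be negative
    somewhere, that is, [xi = 0]. *)
Lemma offspring_prob0_gt0 r : (2 <= r)%N -> 0 < p r -> 0 < p 0%N.
Proof.
move=> r2 pr.
suff : 1 + p r <= 1 + p 0%N by lra.
have p1 k : (p k)%:E = J (fun i => (i == k)%:R).
  rewrite -offspring_probE /J -[in LHS](setIT (xi @^-1` [set k])) -integral_indic//.
    by apply: eq_integral => w _; rewrite indicE mem_fiber.
  exact: measurable_funPTI.
rewrite -lee_fin !EFinD !p1 -{1}(J_cst 1) -J_id -!JD//.
apply: J_le => // i; case: eqP => [->|_].
  have -> : (r == 0%N) = false by case: r r2 {pr}.
  by rewrite addr0 /= -[1 + 1]/(2%:R) ler_nat.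
by case: i => [|i] /=; rewrite ?addr0 ?add0r// ler1n.
Qed.

End OffspringMoments.

(** * Comparison with powers of the size *)

Section Tails.
Variables (R : realType) (r : nat) (eps : R).
Hypotheses (r_ge2 : (2 <= r)%N) (eps_gt0 : 0 < eps).

Let lnr_gt0 : 0 < ln (r%:R : R).
Proof. by rewrite ln_gt0// ltr1n. Qed.

Let r_exp h : (r ^ h)%:R = expR (h%:R * ln r%:R) :> R.
Proof. by rewrite expRM_natl lnK ?natrX// posrE ltr0n; case: r r_ge2. Qed.

Let exp_large (K : R) : exists X : R, forall x, X <= x ->
  0 < x /\ K <= expR (eps * ln x).
Proof.
exists (expR (K / eps)) => x Xx; have x0 : 0 < x by apply: lt_le_trans Xx; exact: expR_gt0.
split=> //; have : K / eps <= ln x by rewrite -ler_expR lnK.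
rewrite ler_pdivrMr// mulrC => h; apply: le_trans (expR_ge1Dx _); lra.
Qed.

(** With [x = ln n], [r ^ h] is at least [x ^ (1 + eps) / r], which exceeds every
    multiple of [x]. *)
Lemma upper_tail (a : R) : 0 < a < 1 -> exists X : R, forall x h, X <= x ->
  (1 + eps) * (ln x / ln r%:R) < h.+1%:R -> a ^+ (r ^ h) <= expR (- (5 * x)).
Proof.
move=> /andP[a0 a1]; have lna : ln a < 0 by rewrite ln_lt0// a0.
have r0 : 0 < r%:R :> R by rewrite ltr0n; case: r r_ge2.
have [X hX] := exp_large (5 * r%:R / - ln a).
exists X => x h /hX[x0 xe] hh.
rewrite -[a in leLHS]lnK ?posrE// -expRM_natl ler_expR.
suff : 5 * x <= (r ^ h)%:R * - ln a by rewrite mulrN lerNr.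
rewrite -ler_pdivrMr ?oppr_gt0//.
have h1 : x * expR (eps * ln x) <= (r ^ h)%:R * r%:R.
  rewrite -natrM -expnSr r_exp -{1}(lnK x0) -expRD ler_expR -ler_pdivrMr//.
  by apply/ltW; apply: le_lt_trans hh; rewrite le_eqVlt; apply/orP; left; apply/eqP; field; rewrite gt_eqF.
have h2 := ler_wpM2l (ltW x0) xe.
rewrite -(ler_pM2r r0); apply: le_trans h1; apply: le_trans h2.
by rewrite le_eqVlt; apply/orP; left; apply/eqP; field; rewrite lt_eqF.
Qed.

(** With [x = ln n], the size [m = O(x ^ (1 - eps))] and [- ln q = O(m)] are both at
    most [x / 4], so that [q * (n / m)] grows like a power of [n]. *)
Lemma lower_tail (b : R) : 0 < b < 1 -> exists X : R, forall x h m n q, X <= x ->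
  h%:R <= (1 - eps) * (ln x / ln r%:R) + 1 ->
  (0 < m)%N -> (m <= 2 * r ^ h)%N -> b ^+ m <= q <= 1 -> n%:R = expR x ->
  (1 - q) ^+ (n %/ m) <= expR (- (3 * x)).
Proof.
move=> /andP[b0 b1]; have lnb : ln b < 0 by rewrite ln_lt0// b0.
have r0 : 0 < r%:R :> R by rewrite ltr0n; case: r r_ge2.
pose D := 8 * r%:R * (1 - ln b).
have D0 : 0 < D by rewrite !mulr_gt0// subr_gt0; lra.
have [X hX] := exp_large D.
(* From [x = 40] on, [(1 + x / 4) ^+ 2 - 1] is at least [3 * x]. *)
exists (Num.max X 40) => x h m n q; rewrite ge_max => /andP[/hX[x0 xe] x40].
move=> hh m0 mh /andP[bq q1] nx.
have mR : m%:R * (4 * (1 - ln b)) <= x.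
  have h1 : (r ^ h)%:R * expR (eps * ln x) <= x * r%:R.
    rewrite r_exp -{2}(lnK x0) -[r%:R in leRHS]lnK// -!expRD ler_expR.
    rewrite -lerBrDr; apply: le_trans (ler_wpM2r (ltW lnr_gt0) hh) _.
    by rewrite le_eqVlt; apply/orP; left; apply/eqP; field; rewrite gt_eqF.
  have h2 : (r ^ h)%:R * D <= x * r%:R.
    by apply: le_trans h1; rewrite ler_wpM2l// ler0n.
  have h3 : (r ^ h)%:R * (8 * (1 - ln b)) <= x.
    rewrite -(ler_pM2r r0); apply: le_trans h2.
    by rewrite le_eqVlt; apply/orP; left; apply/eqP; rewrite /D; ring.
  apply: le_trans h3; have : m%:R <= 2 * (r ^ h)%:R :> R by rewrite -natrM ler_nat.
  move=> h4; have lb0 : 0 <= 4 * (1 - ln b) by lra.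
  have := ler_wpM2r lb0 h4; lra.
have m1 : 1 <= m%:R :> R by rewrite ler1n.
have mx : 4 * m%:R <= x by nra.
have mb : - ln b * m%:R <= x / 4 by nra.
have qx : expR (- (x / 4)) <= q.
  by apply: le_trans bq; rewrite -[b in leRHS]lnK ?posrE// -expRM_natl ler_expR; lra.
have e4 : 1 + x / 4 <= expR (x / 4) by exact: expR_ge1Dx.
have nm : expR (3 * (x / 4)) <= (n %/ m)%:R + 1.
  have : n%:R <= ((n %/ m)%:R + 1) * m%:R :> R.
    by rewrite natr1 -natrM ler_nat ltnW// -ltn_divLR.
  have -> : n%:R = expR (3 * (x / 4)) * expR (x / 4) :> R.
    by rewrite nx -expRD; congr expR; field.
  move=> h1; have : expR (3 * (x / 4)) * m%:R <= ((n %/ m)%:R + 1) * m%:R.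
    apply: le_trans h1; rewrite ler_pM2l ?expR_gt0//; lra.
  by rewrite ler_pM2r// ltr0n.
have q0 : 0 <= q by apply: le_trans qx; exact: expR_ge0.
apply: (@le_trans _ _ (expR (- q) ^+ (n %/ m))).
  by rewrite lerXn2r ?nnegrE ?subr_ge0 ?expR_ge0// expR_ge1Dx.
rewrite -expRM_natl ler_expR mulrN lerN2.
have h1 : expR (x / 4) * expR (x / 4) <= q * ((n %/ m)%:R + 1).
  have -> : expR (x / 4) * expR (x / 4) = expR (- (x / 4)) * expR (3 * (x / 4)).
    by rewrite -!expRD; congr expR; field.
  by rewrite ler_pM ?expR_ge0.
have h2 : (1 + x / 4) * (1 + x / 4) <= expR (x / 4) * expR (x / 4).
  by rewrite ler_pM//; lra.
nra.
Qed.

End Tails.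

(** * Concentration of the height *)

Section CompleteTrees.
Variables (R : realType) (p : nat -> R) (r : nat).
Hypothesis p_ge0 : forall i, 0 <= p i.
Hypothesis q_le1 : forall B, \sum_(0 <= i < B) p i <= 1.

Lemma wpr_no_complete_le n h B : (2 <= r)%N -> (n + r < B)%N ->
  wpr p B n (pcode @` [set t | ~ nonfringe t (complete_tree r h)]) <=
  (1 - wt p (pcode (complete_tree r h))) ^+ (n %/ psize (complete_tree r h)).
Proof.
move=> r2 nB; set c := pcode _.
have cB : all (fun i => i < B)%N c.
  by apply: sub_all (pcode_complete_letters r h) => i /orP[]/eqP ->; lia.
rewrite -size_pcode -/c {1}(divn_eq n (size c)).
apply: le_trans (wpr_no_factor p_ge0 (q_le1 B) _ (n %% size c) cB).
apply: wpr_le => // u _ _ _ [t nt tu] x y uxy; apply: nt.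
exists (complete_tree r h); last exact: prune_refl.
by apply: (@factor_fringe _ _ x y); rewrite tu uxy.
Qed.

Lemma wt_complete_ge h (b : R) : 0 <= b -> b <= p 0%N -> b <= p r ->
  b ^+ psize (complete_tree r h) <= wt p (pcode (complete_tree r h)).
Proof.
move=> b0 b0' br; rewrite -size_pcode.
elim: (pcode _) (pcode_complete_letters r h) => [|i u IH]; first by rewrite /wt big_nil.
move=> /= /andP[i0 /IH h']; rewrite exprS /wt big_cons ler_pM ?exprn_ge0//.
by case/orP: i0 => /eqP ->.
Qed.

End CompleteTrees.

Lemma max_height_deviation (R : realType) (r : nat) (eps L : R) t :
  (0 < r)%N -> 0 < L -> 0 < eps <= 1 ->
  eps < `|(max_height r t)%:R / L - 1| ->
  nonfringe t (complete_tree r (Num.truncn ((1 + eps) * L)).+1) \/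
  ~ nonfringe t (complete_tree r (Num.truncn ((1 - eps) * L)).+1).
Proof.
move=> r0 L0 /andP[eps0 eps1]; have [Hin Hmax] := max_heightP t r0.
rewrite ltr_normr => /orP[gt|lt]; [left|right].
  apply: (@nonfringe_complete_mono _ _ _ _ r0 _ Hin).
  rewrite truncn_lt_nat ?mulr_ge0 ?(ltW L0)//; last by lra.
  by rewrite -ltr_pdivlMr//; lra.
move=> /Hmax; apply/negP; rewrite -ltnNge -(ltr_nat R).
apply: lt_trans (truncnS_gt _).
by rewrite -ltr_pdivrMr//; lra.
Qed.

Section Concentration.
Context d (T : measurableType d) (R : realType) (P : probability T R).
Variables (xi : {RV P >-> nat}) (X : seq nat -> {RV P >-> nat}).
Hypothesis X_offspring : gw_offspring xi X.

Lemma gw_condE n B (A : set ptree) : (n <= B)%N ->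
  gw_cond X n A = wpr (offspring_prob xi) B n (pcode @` A) /
    wpr (offspring_prob xi) B n (range pcode).
Proof.
move=> nB; have [_ EA] := gw_event_size X_offspring A nB.
have [_] := gw_event_size X_offspring setT nB; rewrite setTI => ET.
by rewrite /gw_cond EA ET.
Qed.

Hypothesis xi_mean : ('E_P[fun w : T => (xi w)%:R : R] = 1)%E.
Hypothesis xi_var : ('V_P[fun w : T => (xi w)%:R : R] < +oo)%E.
Variable r : nat.
Hypotheses (r_ge2 : (2 <= r)%N) (xi_r : (0 < P (xi @^-1` [set r]))%E).
Local Notation p := (offspring_prob xi).

(** Before conditioning both deviations have probability [O(n ^- 3)], against
    [c / n ^+ 2] for the size. *)
Lemma max_height_concentration (eps : R) : 0 < eps -> exists C : R,
  \forall n \near \oo, (n = 1 %[mod offspring_span xi])%N ->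
    gw_cond X n [set t |
      eps < `|(max_height r t)%:R / logb r%:R (ln n%:R) - 1|] <= C / n%:R.
Proof.
wlog : eps / eps <= 2^-1 => [small eps0|eps12 eps0].
  have [|//|C hC] := small (Num.min eps 2^-1) _; first by rewrite ge_min lexx orbT.
    by rewrite lt_min eps0 invr_gt0 ltr0n.
  exists C; near=> n => n1.
  apply: le_trans (_ : gw_cond X n [set t |
      Num.min eps 2^-1 < `|(max_height r t)%:R / logb r%:R (ln n%:R) - 1|] <= _).
    rewrite !(gw_condE _ (leqnn n)) ler_wpM2r ?invr_ge0 ?wpr_ge0//;
      try by move=> i; exact: offspring_prob_ge0.
    apply: wpr_le => [i|u _ _ _ [t ht tu]]; first exact: offspring_prob_ge0.
    by exists t => //=; apply: le_lt_trans ht; rewrite ge_min lexx.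
  by move: n1; near: n; exact: hC.
have p_ge0 := offspring_prob_ge0 xi.
have q_le1 := offspring_mass_le1 xi.
have r_gt0 : (0 < r)%N by exact: leq_trans r_ge2.
have pr_gt0 : 0 < p r by rewrite -lte_fin -offspring_probE.
have p0_gt0 := offspring_prob0_gt0 xi_mean r_ge2 pr_gt0.
have pr_lt1 : p r < 1.
  apply: lt_le_trans (q_le1 r.+1); rewrite big_nat_recr//= ltrDr.
  by case: (r) r_gt0 => // k _; rewrite big_nat_recl//= ltr_pwDl// sumr_ge0.
pose b := Num.min (p 0%N) (p r).
have b01 : 0 < b < 1 by rewrite lt_min p0_gt0 pr_gt0 gt_min pr_lt1 orbT.
have a01 : 0 < p r < 1 by rewrite pr_gt0.
have g_span e : (e %| offspring_span xi)%N <->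
    (forall i, (1 <= i)%N /\ 0 < p i -> (e %| i)%N).
  by rewrite gcd_setP; split=> h i [i1 pi]; apply: h; split=> //;
    [rewrite offspring_probE lte_fin|rewrite -lte_fin -offspring_probE].
have [c c0 mass] := tree_mass_ge p_ge0 q_le1 (offspring_second_moment xi_mean xi_var)
  (offspring_mean_tail xi_mean xi_var) (offspring_mass_tail xi_mean xi_var)
  p0_gt0 pr_gt0 r_gt0 g_span.
have [X1 up] := upper_tail r_ge2 eps0 a01.
have [X2 lo] := lower_tail r_ge2 eps0 b01.
exists (5 / c); near=> n => n1.
pose B := (n + r).+1.
have massn : c <= n%:R ^+ 2 * wpr p B n (range pcode).
  by move: n1; rewrite /B; near: n; apply: filterS mass => n h; exact: h.
have nbig : expR (1 + Num.max X1 X2) <= n%:R by near: n; exact: nbhs_infty_ger.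
have n0 : 0 < n%:R :> R by apply: lt_le_trans nbig; exact: expR_gt0.
pose x : R := ln n%:R.
have nx : n%:R = expR x by rewrite lnK.
have x1 : 1 < x.
  have : expR 2 <= n%:R :> R by near: n; exact: nbhs_infty_ger.
  by rewrite nx ler_expR; lra.
have xX : Num.max X1 X2 <= x.
  by move: nbig; rewrite nx ler_expR; lra.
move: xX; rewrite ge_max => /andP[xX1 xX2].
have lnr : 0 < ln (r%:R : R) by rewrite ln_gt0// ltr1n.
pose L := ln x / ln r%:R.
have L0 : 0 < L by rewrite divr_gt0// ln_gt0.
pose h1 := Num.truncn ((1 + eps) * L).
pose h2 := (Num.truncn ((1 - eps) * L)).+1.
have /andP[_ h1g] : h1%:R <= (1 + eps) * L < h1.+1%:R.
  by apply: truncn_itv; rewrite mulr_ge0 ?(ltW L0)//; lra.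
have /andP[h2l _] : (Num.truncn ((1 - eps) * L))%:R <= (1 - eps) * L < h2%:R.
  by apply: truncn_itv; rewrite mulr_ge0 ?(ltW L0)//; lra.
have nB : (n <= B)%N by rewrite /B leqW// leq_addr.
set A := [set t | _].
have split : wpr p B n (pcode @` A) <=
    wpr p B n (pcode @` [set t | nonfringe t (complete_tree r h1.+1)]) +
    wpr p B n (pcode @` [set t | ~ nonfringe t (complete_tree r h2)]).
  pose E (k : bool) := if k then pcode @` [set t | nonfringe t (complete_tree r h1.+1)]
    else pcode @` [set t | ~ nonfringe t (complete_tree r h2)].
  apply: (@le_trans _ _ (\sum_(k <- [:: true; false]) wpr p B n (E k))); last first.
    by rewrite big_cons big_seq1.
  apply: wpr_bigU => // u _ _ _ [t At tu].
  have [||th|th] := @max_height_deviation _ _ eps L t r_gt0 L0; first by rewrite eps0; lra.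
  - exact: At.
  - by exists true => //; exists t.
  - by exists false => //; exists t.
have upn : wpr p B n (pcode @` [set t | nonfringe t (complete_tree r h1.+1)]) <=
    (n.+1 ^ 2)%:R * expR (- (5 * x)).
  apply: wpr_nonfringe_le => // m mn; apply: le_trans (up x h1 xX1 h1g).
  by apply: (wpr_prune_complete X_offspring _ r_gt0); exact: leq_trans mn nB.
pose m := psize (complete_tree r h2).
have m0 : (0 < m)%N by rewrite /m; case: (complete_tree _ _).
have cB : all (fun i => i < B)%N (pcode (complete_tree r h2)).
  by apply: sub_all (pcode_complete_letters r h2) => i /orP[]/eqP ->;
    rewrite /B ?ltnS ?leq_addl.
have lon : wpr p B n (pcode @` [set t | ~ nonfringe t (complete_tree r h2)]) <=
    expR (- (3 * x)).
  have := wpr_no_complete_le p_ge0 q_le1 h2 r_ge2 (ltnSn (n + r)).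
  move=> hh; apply: le_trans hh _.
  apply: (lo x h2) => //.
  - by rewrite /h2 -natr1 lerD2r.
  - by apply/ltnW; exact: psize_complete_le.
  - rewrite wt_complete_ge ?ge_min ?lexx ?orbT//=; last by case/andP: b01 => /ltW.
    by rewrite -(wpr_set1 p erefl cB) wpr_le1.
set W := wpr p B n (range pcode) in massn.
have n2 : 0 < n%:R ^+ 2 :> R by rewrite exprn_gt0.
have W0 : 0 < W by rewrite -(pmulr_rgt0 _ n2); exact: lt_le_trans massn.
rewrite (gw_condE A nB) -/W.
have n1' : 1 <= n%:R :> R by rewrite ler1n -(ltr_nat R).
have expN k : expR (- (k%:R * x)) = (n%:R ^+ k)^-1 by rewrite expRN expRM_natl -nx.
have num : wpr p B n (pcode @` A) <= 5 / n%:R ^+ 3.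
  apply: le_trans split _.
  apply: le_trans (lerD upn lon) _; rewrite !expN.
  have : (n.+1 ^ 2)%:R <= 4 * n%:R ^+ 2 :> R by rewrite natrX -natr1; nra.
  move=> h; apply: (@le_trans _ _ (4 * n%:R ^+ 2 / n%:R ^+ 5 + (n%:R ^+ 3)^-1)).
    by rewrite lerD2r ler_wpM2r// invr_ge0 exprn_ge0// ltW.
  by rewrite le_eqVlt; apply/orP; left; apply/eqP; field; rewrite gt_eqF.
rewrite ler_pdivrMr//; apply: le_trans num _.
have -> : 5 / n%:R ^+ 3 = 5 / c / n%:R * (c / n%:R ^+ 2) by field; rewrite !gt_eqF.
rewrite ler_wpM2l//; first by rewrite !divr_ge0// ltW.
by rewrite ler_pdivrMr// mulrC.
Unshelve. all: by end_near.
Qed.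
End Concentration.

Theorem lemma27 (d : measure_display) (T : measurableType d) (R : realType)
    (P : probability T R) (xi : {RV P >-> nat})
    (X : seq nat -> {RV P >-> nat}) (r : nat)
    (xi_mean : ('E_P[fun w : T => (xi w)%:R : R] = 1)%E)
    (xi_var : (0 < 'V_P[fun w : T => (xi w)%:R : R] < +oo)%E)
    (X_offspring : gw_offspring xi X)
    (r_ge2 : (2 <= r)%N)
    (xi_r : (0 < P (xi @^-1` [set r]))%E) :
  forall eps : R, 0 < eps ->
    gw_cond X n
      [set t | eps < `|(max_height r t)%:R / logb r%:R (ln n%:R) - 1|]
    @[n --> within [set n | (n = 1 %[mod offspring_span xi])%N] \oo] --> 0.
Proof.
move=> eps eps0; have /andP[_ var_fin] := xi_var.
have [C hC] := max_height_concentration X_offspring xi_mean var_fin r_ge2 xi_r eps0.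
apply/cvgr0Pnorm_lt => e e0; rewrite near_withinE; near=> n => n1.
rewrite (gw_condE X_offspring _ (leqnn n)).
rewrite ger0_norm ?divr_ge0 ?wpr_ge0//; try by move=> i; exact: offspring_prob_ge0.
rewrite -(gw_condE X_offspring _ (leqnn n)).
have n0 : 0 < n%:R :> R.
  by rewrite ltr0n; near: n; exact: nbhs_infty_gt.
apply: (@le_lt_trans _ _ (C / n%:R)); first by move: n1; near: n; exact: hC.
have nC : C / e + 1 <= n%:R by near: n; exact: nbhs_infty_ger.
rewrite ltr_pdivrMr// mulrC -ltr_pdivrMr//; lra.
Unshelve. all: by end_near.
Qed.
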